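(* Let $p>1$ be an integer, put $q=1/p$, and let $h_p(1)=\sum_{k=1}^\infty \frac{1}{p^k-1}$. For $n\ge 1$ define $$b_n = d_n(p)\,P_n(p^n|q),\qquad a_n = d_n(p)\,Q_n(p^n|q) + b_n\sum_{k=1}^{n-1}\frac{1}{p^k-1},$$ where $d_n(p)$ is the product of the first $n$ cyclotomic polynomials evaluated at $p$, $P_n(\cdot|q)$ is the little $q$-Legendre polynomial and $Q_n(\cdot|q)$ its associated polynomial (all defined in the context). Then $a_n\in\mathbb{Z}$ and $(-1)^n b_n\in\mathbb{N}=\{1,2,\ldots\}$, and $(-1)^n\,(b_n h_p(1)-a_n)>0$ for $n>1$. Furthermore $$\lim_{n\to\infty}|b_n h_p(1)-a_n|^{1/n^2} = p^{-\frac{3(\pi^2-2)}{2\pi^2}}<1.$$ Consequently $h_p(1)$ is irrational, and its measure of irrationality satisfies $r(h_p(1))\le \frac{2\pi^2}{\pi^2-2}$ $(=2.50828\ldots)$.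
   Context: For $0<q<1$ let $(a;q)_0=1$ and $(a;q)_k=(1-a)(1-aq)\cdots(1-aq^{k-1})$. The little $q$-Legendre polynomials are $$P_n(x|q)=\sum_{k=0}^n \frac{(q^{-n};q)_k\,(q^{n+1};q)_k}{(q;q)_k\,(q;q)_k}\,q^k x^k .$$ The associated polynomial $Q_n(x|q)$ (of degree $n-1$ in $x$) is $$Q_n(x|q)=\sum_{j=0}^\infty \frac{P_n(x|q)-P_n(q^j|q)}{x-q^j}\,q^j .$$ $d_n(p)=\prod_{k=1}^n\Phi_k(p)$, where $\Phi_k$ is the $k$-th cyclotomic polynomial. The measure of irrationality of an irrational real number $x$ is $$r(x)=\inf\{r\in\mathbb{R}: |x-a/b|<1/b^r \text{ has at most finitely many integer solutions } (a,b) \text{ with } b\ge 1\}.$$ *)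

(* Defs.v *)
From HB Require Import structures.
From mathcomp Require Import all_boot all_order all_algebra all_field.
From mathcomp Require Import all_classical all_reals all_analysis.

Set Implicit Arguments.
Unset Strict Implicit.
Unset Printing Implicit Defensive.

Import Order.TTheory GRing.Theory Num.Theory.
Import numFieldNormedType.Exports.

Local Open Scope classical_set_scope.
Local Open Scope ring_scope.

Definition qpoch (R : realType) (a q : R) (k : nat) : R :=
  \prod_(i < k) (1 - a * q ^+ i).

Definition little_qLegendre (R : realType) (q : R) (n : nat) : {poly R} :=
  \sum_(k < n.+1)
    ((qpoch (q ^- n) q k * qpoch (q ^+ n.+1) q k)
       / (qpoch q q k * qpoch q q k) * q ^+ k) *: 'X^k.

(* The difference quotient (P(x) - P(q^j)) / (x - q^j) is the exact quotient of
   polynomials, so that it has the right value also at x = q^j. *)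
Definition little_qLegendre_assoc (R : realType) (q : R) (n : nat) (x : R) : R :=
  let P := little_qLegendre q n in
  limn (fun N : nat => \sum_(0 <= j < N)
    (((P - (P.[q ^+ j])%:P) %/ ('X - (q ^+ j)%:P)).[x] * q ^+ j)).

Definition cyclotomic_prod (n : nat) (p : int) : int :=
  \prod_(1 <= k < n.+1) ('Phi_k).[p].

Definition qharmonic (R : realType) (p : nat) : R :=
  limn (fun N : nat => \sum_(1 <= k < N) (p%:R ^+ k - 1 : R)^-1).

Definition approx_b (R : realType) (p n : nat) : R :=
  (cyclotomic_prod n p%:Z)%:~R * (little_qLegendre (p%:R^-1) n).[p%:R ^+ n].

Definition approx_a (R : realType) (p n : nat) : R :=
  (cyclotomic_prod n p%:Z)%:~R
    * little_qLegendre_assoc (p%:R^-1) n (p%:R ^+ n)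
  + approx_b R p n * \sum_(1 <= k < n) (p%:R ^+ k - 1)^-1.

(* The infimum is taken in the extended reals: it is +oo when no exponent is
   admissible (Liouville numbers). *)
Definition irrationality_measure (R : realType) (x : R) : \bar R :=
  ereal_inf [set r%:E | r in [set r : R |
    finite_set [set ab : int * int | 1 <= ab.2 /\
      `|x - ab.1%:~R / ab.2%:~R| < 1 / (ab.2%:~R `^ r)]]].

(* Main.v *)
(** One has [b_n h - a_n = d_n R_n] with
    [R_n = \sum_j P_n(q^j) q^j / (p^n - q^j)]; since [P_n] is orthogonal to the
    polynomials of degree less than [n] for the weights [q^j], also
    [P_n(p^n) R_n = \sum_j P_n(q^j)^2 q^j / (p^n - q^j)].  This gives the sign of
    [R_n], and, as [|P_n(q^j)| <= 3^n] and [P_n(q^j) -> 1], the value of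
    [log |R_n| + log |P_n(p^n)|] up to [O(n)], while
    [log |P_n(p^n)| = (3/2) n^2 log p + O(n)].
    Orthogonality, the bounds and the integrality of [P_n(p^m)] all come from the
    q-binomial theorem, which gives a dual expansion of [P_n].
    The growth of [d_n] follows from
    [\sum_(e <= n) log d_(n/e) = \sum_(k <= n) log (p^k - 1)] and
    [\sum_e 1/e^2 = pi^2/6]: the deviation of [log d_n] from the expected quadratic
    is bounded by the sum of the deviations at [n/e], [e >= 2], a contraction
    because [\sum_(e >= 2) 1/e^2 < 1].  Euler's sum itself, and from it the
    decimals of [pi], come from [1/sin^2 x + 1/cos^2 x = 4/sin^2 (2x)]. *)
Require Import Defs.
From HB Require Import structures.
From mathcomp Require Import all_boot all_order all_algebra all_field.
From mathcomp Require Import all_classical all_reals all_analysis.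
From mathcomp Require Import ring lra zify.
Import Order.TTheory GRing.Theory Num.Theory.
Import numFieldNormedType.Exports.
Local Open Scope classical_set_scope.
Local Open Scope ring_scope.

(** Evaluating at [x = p^n] does two jobs. The tail of [h] from index [n] on is a Stieltjes
    transform taken at [p^n], so [P_n] and [Q_n] approximate it; and [p^n] clears the powers of [p]
    in the denominators of the coefficients of [P_n]. The denominators that remain in [a_n] are
    numbers [p^m - 1] with [m <= n]. Their common multiple [d_n] costs only [(3/pi^2) n^2 log p],
    less than the [(3/2) n^2 log p] gained from [R_n]. With [A = (3/2 - 3/pi^2) log p] and
    [B = (3/2 + 3/pi^2) log p] the linear forms decay like [e^(-A n^2)] and [b_n] grows like
    [e^(B n^2)], whence the measure [1 + B/A = 2 pi^2 / (pi^2 - 2)]. The contraction argument for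
    [d_n] gives no rate, so the final asymptotics are stated up to [o(n^2)]. This is enough because
    [(n - 1)^2 / n^2] tends to 1: passing from one index to the next costs nothing in the
    exponent. *)

Fixpoint gauss_binomial (p n k : nat) : nat :=
  match n, k with
  | _, 0 => 1
  | 0, _.+1 => 0
  | n'.+1, k'.+1 =>
      gauss_binomial p n' k' + p ^ k'.+1 * gauss_binomial p n' k'.+1
  end.

Arguments gauss_binomial : simpl never.

(** * Gaussian binomials at [p], and the values of [P_n] at powers of [p] *)

Section GaussBinomial.
Variables (R : archiRealFieldType) (p : nat).
Hypothesis p_gt1 : (1 < p)%N.
Local Notation pr := (p%:R : R).
Local Notation gb := (gauss_binomial p).
Local Notation gbr n k := ((gauss_binomial p n k)%:R : R).

(** This is [(q;q)_k] at [q = 1/p], multiplied by [p ^ 'C(k.+1, 2)]. *)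
Definition qfact (k : nat) : R := \prod_(i < k) (pr ^+ i.+1 - 1).
Local Notation F := qfact.

Lemma pr_gt1 : 1 < pr. Proof. by rewrite ltr1n. Qed.
Lemma pr_gt0 : 0 < pr. Proof. exact: lt_trans pr_gt1. Qed.
Lemma pr_neq0 : pr != 0. Proof. by rewrite gt_eqF // pr_gt0. Qed.

Lemma exprSp_gt1 i : 1 < pr ^+ i.+1.
Proof. by rewrite exprn_egt1 // pr_gt1. Qed.

Lemma qfact_gt0 k : 0 < F k.
Proof. by apply: prodr_gt0 => i _; rewrite subr_gt0 exprSp_gt1. Qed.

Lemma qfact_neq0 k : F k != 0. Proof. by rewrite gt_eqF // qfact_gt0. Qed.

Lemma qfactS k : F k.+1 = F k * (pr ^+ k.+1 - 1).
Proof. by rewrite /qfact big_ord_recr. Qed.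

Lemma gauss_binomial0 n : gb n 0 = 1%N. Proof. by case: n. Qed.

Lemma gauss_binomialS n k :
  gb n.+1 k.+1 = (gb n k + p ^ k.+1 * gb n k.+1)%N.
Proof. by []. Qed.

Lemma gauss_binomial_small n k : (n < k)%N -> gb n k = 0%N.
Proof.
elim: n k => [|n IH] [|k] //; rewrite ltnS => nk.
by rewrite gauss_binomialS !IH // ?muln0 // ltnW.
Qed.

Lemma gauss_binomialnn n : gb n n = 1%N.
Proof.
elim: n => // n IH; rewrite gauss_binomialS IH gauss_binomial_small //.
by rewrite muln0.
Qed.

(** The Pascal recursion makes integrality immediate; this identity recovers the quotient of
    products, and with it the algebra. The double induction combines the two entries of the row
    above, both rescaled to the denominator of the new one. *)
Lemma gauss_binomial_fact m k : gbr (m + k) k * (F k * F m) = F (m + k).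
Proof.
elim: m k => [|m IHm] k.
  by rewrite add0n gauss_binomialnn mul1r /qfact big_ord0 mulr1.
elim: k => [|k IHk].
  by rewrite addn0 gauss_binomial0 mul1r /qfact big_ord0 mul1r.
have e1 : gbr (m.+1 + k)%N k * (F k.+1 * F m.+1) =
   F (m.+1 + k)%N * (pr ^+ k.+1 - 1) by rewrite -IHk qfactS; ring.
have e2 : gbr (m + k.+1)%N k.+1 * (F k.+1 * F m.+1) =
   F (m.+1 + k)%N * (pr ^+ m.+1 - 1).
  by rewrite addSnnS -IHm (qfactS m); ring.
rewrite addnS gauss_binomialS natrD natrM natrX [in RHS]qfactS mulrDl e1 -mulrA.
by rewrite {2}addSnnS e2 -addnS exprD; ring.
Qed.

(** The first factor [1 - z] is split off and the induction hypothesis is used at [z * p]; comparing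
    coefficients is then Pascal's rule. *)
Lemma qbinomial_theorem n (z : R) :
  \sum_(k < n.+1) (-1) ^+ k * gbr n k * pr ^+ 'C(k, 2) * z ^+ k =
  \prod_(i < n) (1 - z * pr ^+ i).
Proof.
elim: n z => [|n IH] z.
  by rewrite big_ord1 big_ord0 !mulr1.
rewrite [RHS]big_ord_recl /= expr0 mulr1.
have -> : \prod_(i < n) (1 - z * pr ^+ (lift ord0 i)) =
  \prod_(i < n) (1 - (z * pr) * pr ^+ i).
  by apply: eq_bigr => i _; rewrite lift0 exprS mulrA.
rewrite -IH mulrBl mul1r.
have split_sum : \sum_(k < n.+1) (-1) ^+ k * gbr n k * pr ^+ 'C(k, 2) * (z * pr) ^+ k =
    1 + \sum_(k < n.+1) (-1) ^+ k.+1 * gbr n k.+1 * pr ^+ 'C(k.+1, 2) * (z * pr) ^+ k.+1.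
  rewrite big_ord_recl [in RHS]big_ord_recr /= (@gauss_binomial_small n n.+1) //.
  rewrite gauss_binomial0 !expr0 !mulr1 mulr0 !mul0r addr0.
  by congr (_ + _); apply: eq_bigr => i _; rewrite /bump add1n.
rewrite [in X in _ = X - _]split_sum big_ord_recl /= gauss_binomial0 !expr0 !mulr1.
rewrite -addrA; congr (_ + _).
rewrite mulr_sumr -sumrB; apply: eq_bigr => k _.
rewrite /bump add1n gauss_binomialS natrD natrM natrX !binS bin1 !exprD !exprS !exprMn; ring.
Qed.

Lemma prod_qfact k a : \prod_(i < k) (pr ^+ (a + i).+1 - 1) * F a = F (a + k).
Proof.
elim: k => [|k IH]; first by rewrite big_ord0 mul1r addn0.
by rewrite big_ord_recr /= mulrAC IH addnS -qfactS.
Qed.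

(** The coefficient of [x ^ k] in [P_n(x|1/p)], with all q-Pochhammer symbols replaced by natural
    numbers; its only denominator is [p ^ (n * k)]. *)
Definition legendre_coef n k : R :=
  (-1) ^+ k * gbr n k * gbr (n + k)%N n * pr ^+ 'C(k, 2) * pr ^- (n * k).

Lemma gauss_binomial_shift n k :
  gbr (n + k)%N n * F n = \prod_(i < n) (pr ^+ (k + i).+1 - 1).
Proof.
apply: (mulIf (qfact_neq0 k)); rewrite prod_qfact -mulrA addnC.
exact: gauss_binomial_fact.
Qed.

Lemma gauss_binomial_shiftE n k :
  gbr (n + k)%N n = (\prod_(i < n) (pr ^+ (k + i).+1 - 1)) / F n.
Proof. by rewrite -gauss_binomial_shift mulfK // qfact_neq0. Qed.

Lemma legendre_coefX n k (z : R) :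
  legendre_coef n k * (pr ^+ n * z) ^+ k =
  (-1) ^+ k * gbr n k * pr ^+ 'C(k, 2) * z ^+ k * gbr (n + k)%N n.
Proof.
rewrite /legendre_coef exprMn exprM.
have Hn : pr ^+ n ^+ k != 0 by rewrite !expf_neq0 ?pr_neq0.
by field.
Qed.

(** The binomial [n + k] over [n] is a product of [n] factors [p ^ (k + i).+1 - 1] divided by [F n].
    Expanding this product by the q-binomial theorem and exchanging the sums turns the sum over [k]
    into a q-binomial sum at [z * p ^ r]. The resulting products vanish at many powers of [p], which
    is what makes the form useful. *)
Lemma legendre_dual n (z : R) :
  (\sum_(k < n.+1) legendre_coef n k * (pr ^+ n * z) ^+ k) * F n =
  (-1) ^+ n * \sum_(r < n.+1) (-1) ^+ r * gbr n r * pr ^+ 'C(r.+1, 2) *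
      \prod_(i < n) (1 - z * pr ^+ (r + i)).
Proof.
transitivity (\sum_(k < n.+1) (-1) ^+ n * ((-1) ^+ k * gbr n k * pr ^+ 'C(k, 2)
   * z ^+ k * \prod_(i < n) (1 - (pr * pr ^+ k) * pr ^+ i))).
  rewrite mulr_suml; apply: eq_bigr => k _.
  have -> : \prod_(i < n) (1 - pr * pr ^+ k * pr ^+ i) =
      (-1) ^+ n * (gbr (n + k)%N n * F n).
    rewrite gauss_binomial_shift -[n in (-1) ^+ n]card_ord -prodrN.
    apply: eq_bigr => i _.
    by rewrite opprB -exprS -exprD addSn.
  rewrite legendre_coefX; have := sqrr_sign R n.
  by move: ((-1) ^+ n) => e e2; rewrite -[LHS]mul1r -[X in X * _ = _]e2; ring.
rewrite -mulr_sumr; congr (_ * _).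
under eq_bigr => k _ do rewrite -qbinomial_theorem mulr_sumr.
rewrite exchange_big /=; apply: eq_bigr => r _.
have -> : \prod_(i < n) (1 - z * pr ^+ (r + i)) =
    \prod_(i < n) (1 - (z * pr ^+ r) * pr ^+ i).
  by apply: eq_bigr => i _; rewrite exprD mulrA.
rewrite -qbinomial_theorem mulr_sumr; apply: eq_bigr => k _.
by rewrite binS bin1 exprD !exprMn -!exprM [(k * r)%N]mulnC; ring.
Qed.

Lemma legendre_at_int n m : (0 < m)%N ->
  \sum_(k < n.+1) legendre_coef n k * (pr ^+ m) ^+ k =
  \sum_(r < n.+1 | (n < r + m)%N) (-1) ^+ r *
    (gb n r * p ^ 'C(r.+1, 2) * gb (n + (r + m - n).-1) n)%:R.
Proof.
move=> m_gt0; apply: (mulIf (qfact_neq0 n)).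
have -> : pr ^+ m = pr ^+ n * (pr ^- n * pr ^+ m).
  by rewrite mulrA divff ?mul1r // expf_neq0 // pr_neq0.
rewrite legendre_dual (bigID (fun r : 'I_n.+1 => (n < r + m)%N)) /=.
rewrite [X in _ + X]big1 ?addr0; last first.
  move=> r; rewrite -leqNgt => rmn.
  (* Here [z = p ^ (m - n)], so for [r + m <= n] the factor [i = n - (r + m)] is zero; [m > 0] keeps
     this index in range. *)
  have i_lt : (n - (r + m) < n)%N by lia.
  rewrite (bigD1 (Ordinal i_lt)) //= mulrC -!mulrA -exprD.
  rewrite (_ : (m + _ = n)%N); last by lia.
  by rewrite mulVf ?expf_neq0 ?pr_neq0 // subrr mul0r.
rewrite mulr_sumr mulr_suml; apply: eq_bigr => r nrm.
rewrite !natrM natrX -!mulrA gauss_binomial_shift.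
have -> : \prod_(i < n) (1 - pr ^- n * pr ^+ m * pr ^+ (r + i)) =
   (-1) ^+ n * \prod_(i < n) (pr ^+ ((r + m - n).-1 + i).+1 - 1).
  rewrite -[n in (-1) ^+ n]card_ord -prodrN.
  apply: eq_bigr => i _; rewrite opprB -mulrA -exprD.
  rewrite (_ : (m + (r + i) = n + ((r + m - n).-1 + i).+1)%N); last by lia.
  by rewrite exprD mulKf // expf_neq0 // pr_neq0.
have := sqrr_sign R n.
by move: ((-1) ^+ n) => e e2; rewrite -[RHS]mul1r -[X in _ = X * _]e2; ring.
Qed.

(** For [m < n] the powers [p ^ (m * k)] need not clear the denominators [p ^ (n * k)] term by term;
    the dual expansion is a sum of integers all the same. *)
Lemma legendre_at_int_int n m : (0 < m)%N ->
  \sum_(k < n.+1) legendre_coef n k * (pr ^+ m) ^+ k \is a Num.int.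
Proof.
move=> m_gt0; rewrite legendre_at_int //; apply: rpred_sum => r _.
by rewrite rpredM ?rpredX ?rpredN ?rpred1 // ?rpred_nat.
Qed.

(** At [z = p ^ -(n + j)] every product of the dual expansion lies in [[0, 1]], so the sum is at
    most [\prod_i (1 + p ^ i.+1)]; since [1 + y <= 3 * (y - 1)] for [y >= 2], this is at most
    [3 ^ n * F n]. *)
Lemma legendre_at_expV_bound n j :
  `|\sum_(k < n.+1) legendre_coef n k * (pr ^- j) ^+ k| <= 3 ^+ n.
Proof.
have F0 := qfact_gt0 n.
have H3 : \prod_(i < n) (1 + pr * pr ^+ i) <= 3 ^+ n * F n.
  rewrite -[n in 3 ^+ n]card_ord -prodr_const -big_split /=.
  apply: ler_prod => i _; rewrite -exprS.
  have : pr <= pr ^+ i.+1 by rewrite -[leLHS]expr1 ler_eXn2l ?pr_gt1.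
  have : 2 <= pr by rewrite ler_nat.
  by move=> ? ?; apply/andP; split; lra.
rewrite -(ler_pM2r F0); apply: le_trans H3; rewrite -[F n in leLHS]gtr0_norm //.
rewrite -normrM.
have -> : pr ^- j = pr ^+ n * (pr ^- n * pr ^- j).
  by rewrite mulrA divff ?mul1r // expf_neq0 // pr_neq0.
rewrite legendre_dual normrM normrX normrN1 expr1n mul1r.
apply: le_trans (ler_norm_sum _ _ _) _.
have -> : \prod_(i < n) (1 + pr * pr ^+ i) = \prod_(i < n) (1 - (- pr) * pr ^+ i).
  by apply: eq_bigr => i _; rewrite mulNr opprK.
rewrite -qbinomial_theorem; apply: ler_sum => r _.
have -> : (-1) ^+ r * (gb n r)%:R * pr ^+ 'C(r, 2) * (- pr) ^+ r =
   (gb n r)%:R * pr ^+ 'C(r.+1, 2).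
  rewrite binS bin1 exprD [(- pr) ^+ r]exprNn; have := sqrr_sign R r.
  by move: ((-1) ^+ r) => e e2; rewrite -[RHS]mul1r -[X in _ = X * _]e2; ring.
rewrite !normrM normrX normrN1 expr1n mul1r normr_nat normrX normr_nat.
rewrite ler_piMr ?mulr_ge0 ?ler0n ?exprn_ge0 //.
rewrite -invfM -exprD.
have fac i : pr ^- (n + j) * pr ^+ (r + i) = pr ^+ (r + i) / pr ^+ (n + j).
  by rewrite mulrC.
(* If [r > j], the factor [i = n + j - r] is zero; if [r <= j], all exponents [r + i] are below
   [n + j] and each factor is in [[0, 1]]. *)
have [rj|jr] := leqP r j; last first.
  have i_lt : (n + j - r < n)%N by have := leq_ord r; lia.
  have re : (r + (n + j - r))%N = (n + j)%N.
    by rewrite subnKC // (leq_trans (leq_ord r)) // leq_addr.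
  rewrite (bigD1 (Ordinal i_lt)) //= re.
  by rewrite mulVf ?expf_neq0 ?pr_neq0 // subrr mul0r normr0 ler01.
rewrite normr_prod; apply: prodr_ile1 => i _ /=; rewrite normr_ge0 /= fac.
have h0 : 0 <= pr ^+ (r + i) / pr ^+ (n + j).
  by rewrite divr_ge0 // exprn_ge0 // ltW // pr_gt0.
have h1 : pr ^+ (r + i) / pr ^+ (n + j) <= 1.
  rewrite ler_pdivrMr ?exprn_gt0 ?pr_gt0 // mul1r ler_weXn2l ?ltW ?pr_gt1 //.
  by have := ltn_ord i; lia.
by rewrite ger0_norm ?subr_ge0 // lerBlDr lerDl.
Qed.

Lemma prX_gt0 m : 0 < pr ^+ m. Proof. by rewrite exprn_gt0 // pr_gt0. Qed.

Lemma prV_gt0 m : 0 < pr ^- m. Proof. by rewrite invr_gt0 prX_gt0. Qed.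

Lemma prV_le m k : (m <= k)%N -> pr ^- k <= pr ^- m.
Proof. by move=> mk; rewrite lef_pV2 ?posrE ?prX_gt0 // ler_weXn2l ?ltW ?pr_gt1. Qed.

(** Each of the [n] factors [(p ^ (k + i).+1 - 1) / (p ^ i.+1 - 1)] lies between [p ^ k] and
    [2 * p ^ k]. *)
Lemma gauss_binomial_bounds n k :
  pr ^+ (n * k) <= gbr (n + k)%N n <= 2 ^+ n * pr ^+ (n * k).
Proof.
rewrite gauss_binomial_shiftE ler_pdivrMr ?qfact_gt0 // ler_pdivlMr ?qfact_gt0 //.
have cst (c : R) : c ^+ n = \prod_(i < n) c by rewrite prodr_const card_ord.
rewrite mulnC exprM -exprMn !cst /qfact -!big_split /=.
have fac (i : nat) : 0 <= pr ^+ i.+1 - 1 by rewrite subr_ge0 ltW // exprSp_gt1.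
have k0 : 1 <= pr ^+ k by rewrite exprn_ege1 // ltW // pr_gt1.
have pi2 (i : nat) : 2 <= pr ^+ i.+1.
  rewrite -natrX ler_nat (leq_trans p_gt1) //.
  by rewrite -[leqLHS]expn1 leq_exp2l.
apply/andP; split; apply: ler_prod => i _; apply/andP; split.
- by rewrite mulr_ge0 ?fac // (le_trans _ k0).
- by rewrite -addnS exprD mulrBr mulr1 lerB.
- by rewrite fac.
- rewrite -addnS exprD.
  have := pi2 i; move: (pr ^+ i.+1) (pr ^+ k) k0 => a b ? ?; nra.
Qed.

(** The constant term is 1, and the others amount to at most [2 ^ n * p ^ (n - j) * 2 ^ n]: one
    [2 ^ n] comes from [gauss_binomial_bounds], the other from the q-binomial product at [- p ^ -n].
    For [j > 3 * n] one has [p ^ (j - n) >= 2 ^ (2 * n + 1)], which leaves at most 1/2. *)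
Lemma legendre_at_expV_near1 n j : (3 * n < j)%N ->
  1 / 2 <= \sum_(k < n.+1) legendre_coef n k * (pr ^- j) ^+ k.
Proof.
move=> nj.
have pj0 := prV_gt0 j.
rewrite big_ord_recl /legendre_coef /= gauss_binomial0 addn0 gauss_binomialnn.
rewrite !expr0 muln0 expr0 invr1 !mulr1 -lerBlDl.
suff : `|\sum_(i < n) legendre_coef n i.+1 * (pr ^- j) ^+ i.+1| <= 1 / 2.
  by rewrite ler_norml => /andP[+ _]; apply: le_trans; lra.
apply: le_trans (ler_norm_sum _ _ _) _.
have : \sum_(i < n) `|legendre_coef n i.+1 * (pr ^- j) ^+ i.+1| <=
  \sum_(i < n) 2 ^+ n * (pr ^+ n / pr ^+ j) * (gbr n i.+1 * pr ^+ 'C(i.+1, 2) * (pr ^- n) ^+ i.+1).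
  apply: ler_sum => i _.
  rewrite /legendre_coef !normrM !normrX normrN1 expr1n mul1r !normr_nat.
  have /andP[_ ub] := gauss_binomial_bounds n i.+1.
  rewrite normfV !normrX !normr_nat [`|pr ^- j|]gtr0_norm //.
  have e1 : gbr (n + i.+1)%N n * pr ^- (n * i.+1) <= 2 ^+ n.
    by rewrite ler_pdivrMr // exprn_gt0 // pr_gt0.
  have e2 : (pr ^- j) ^+ i.+1 <= pr ^+ n / pr ^+ j * (pr ^- n) ^+ i.+1.
    rewrite !exprS mulrACA divff ?expf_neq0 ?pr_neq0 // mul1r ler_pM2l //.
    rewrite lerXn2r ?nnegrE ?(ltW (prV_gt0 _)) //.
    by apply: prV_le; lia.
  rewrite [leLHS](_ : _ = gbr n i.+1 * pr ^+ 'C(i.+1, 2) *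
      ((gbr (n + i.+1)%N n * pr ^- (n * i.+1)) * (pr ^- j) ^+ i.+1)); last by ring.
  rewrite [leRHS](_ : _ = gbr n i.+1 * pr ^+ 'C(i.+1, 2) *
      (2 ^+ n * (pr ^+ n / pr ^+ j * (pr ^- n) ^+ i.+1))); last by ring.
  apply: ler_wpM2l; first by rewrite mulr_ge0 ?exprn_ge0 ?ler0n.
  by apply: ler_pM => //; rewrite ?mulr_ge0 ?ler0n ?invr_ge0 ?exprn_ge0 ?ler0n // ltW.
move=> /le_trans; apply; rewrite -mulr_sumr.
have : \sum_(i < n) gbr n i.+1 * pr ^+ 'C(i.+1, 2) * (pr ^- n) ^+ i.+1 <= 2 ^+ n.
  have := qbinomial_theorem n (- pr ^- n).
  rewrite big_ord_recl => e.
  have {e} : 1 + \sum_(i < n) gbr n i.+1 * pr ^+ 'C(i.+1, 2) * (pr ^- n) ^+ i.+1 =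
    \prod_(i < n) (1 + pr ^- n * pr ^+ i).
    transitivity (\prod_(i < n) (1 - (- pr ^- n) * pr ^+ i)).
      rewrite -e gauss_binomial0 !expr0 !mulr1; congr (_ + _).
      apply: eq_bigr => i _; rewrite lift0 [(- pr ^- n) ^+ _]exprNn.
      have := sqrr_sign R i.+1.
      by move: ((-1) ^+ i.+1) => u u2; rewrite -[LHS]mul1r -[X in X * _ = _]u2; ring.
    by apply: eq_bigr => i _; rewrite mulNr opprK.
  have : \prod_(i < n) (1 + pr ^- n * pr ^+ i) <= 2 ^+ n.
    rewrite -[n in 2 ^+ n]card_ord -prodr_const; apply: ler_prod => i _.
    have : 0 <= pr ^- n * pr ^+ i.
      by rewrite mulr_ge0 ?invr_ge0 ?exprn_ge0 ?ltW ?pr_gt0.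
    have : pr ^- n * pr ^+ i <= 1.
      rewrite mulrC ler_pdivrMr ?exprn_gt0 ?pr_gt0 // mul1r.
      by rewrite ler_weXn2l ?ltW ?pr_gt1 // ltnW.
    by lra.
  by lra.
have -> : pr ^+ n / pr ^+ j = pr ^- (n * 2 + (j - 3 * n)).
  rewrite -[j in LHS](subnKC (ltnW nj)) [(3 * n)%N](_ : _ = n + n * 2)%N; last by lia.
  rewrite !exprD !invfM mulrA mulrA divff ?expf_neq0 ?pr_neq0 // mul1r.
  by [].
have h2p : 2 <= pr by rewrite ler_nat.
set S := \sum_(i < n) _ => HS.
have : pr ^- (n * 2 + (j - 3 * n)) <= 2 ^- (n * 2 + 1).
  rewrite lef_pV2 ?posrE ?prX_gt0 ?exprn_gt0 //.
  apply: (@le_trans _ _ (pr ^+ (n * 2 + 1))).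
    by rewrite lerXn2r ?nnegrE ?(le_trans _ h2p).
  by rewrite ler_weXn2l ?ltW ?pr_gt1 //; lia.
move=> H1.
apply: (@le_trans _ _ (2 ^+ n * 2 ^- (n * 2 + 1) * 2 ^+ n)).
  apply: ler_pM => //.
  - apply: sumr_ge0 => i _.
    by rewrite mulr_ge0 ?exprn_ge0 ?(ltW (prV_gt0 _)) // mulr_ge0 ?exprn_ge0 ?ler0n.
  - by rewrite ler_pM2l ?exprn_gt0.
rewrite exprD expr1 muln2 -addnn exprD.
have : (2 : R) ^+ n != 0 by rewrite expf_neq0 // pnatr_eq0.
move: ((2 : R) ^+ n) => a a0.
by rewrite [leLHS](_ : _ = 1 / 2) //; field.
Qed.

(** This is the moment of order [s] of [P_n] with the geometric series in [j] already summed. The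
    denominator cancels the factor [i = s] of the binomial [n + k] over [n], leaving a polynomial
    [D] of degree below [n] in [p ^ k]; each monomial gives a q-binomial sum, that is, a product
    with a zero factor. *)
Lemma legendre_orthogonal n s : (s < n)%N ->
  \sum_(k < n.+1) legendre_coef n k / (1 - pr ^- (k + s).+1) = 0.
Proof.
move=> sn.
pose D : {poly R} := \prod_(i < n | i != Ordinal sn) ((pr ^+ i.+1)%:P * 'X - 1).
have DE k : D.[pr ^+ k] * (pr ^+ (k + s).+1 - 1) = gbr (n + k)%N n * F n.
  rewrite gauss_binomial_shift (bigD1 (Ordinal sn)) //= mulrC; congr (_ * _).
  rewrite /D horner_prod; apply: eq_bigr => i _.
  by rewrite !hornerE -exprD addSn addnC.
have sizeD : (size D <= n)%N.
  apply: leq_trans (size_prod_leq _ _) _.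
  have : (\sum_(i < n | i != Ordinal sn) size ((pr ^+ i.+1)%:P * 'X - 1)%R
      <= \sum_(i < n | i != Ordinal sn) 2)%N.
    apply: leq_sum => i _; rewrite (leq_trans (size_polyD _ _)) // geq_max size_polyN size_poly1.
    by rewrite mul_polyC (leq_trans (size_scale_leq _ _)) // size_polyX.
  have cE : #|[pred i : 'I_n | i != Ordinal sn]| = n.-1.
    by rewrite (cardC1 (Ordinal sn)) card_ord.
  rewrite sum_nat_const.
  rewrite (eq_card (B := [pred i : 'I_n | i != Ordinal sn])) // cE => H.
  by rewrite leq_subLR (leq_trans (n := (n.-1 * 2).+1)) //; lia.
have term (k : nat) : legendre_coef n k / (1 - pr ^- (k + s).+1) = \sum_(r < n)
    (D`_r * pr ^+ s.+1 / F n) * ((-1) ^+ k * gbr n k * pr ^+ 'C(k, 2) * (pr ^- n * pr ^+ r.+1) ^+ k).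
  have hz : pr ^+ (k + s).+1 - 1 != 0 by rewrite subr_eq0 gt_eqF // exprSp_gt1.
  have -> : 1 - pr ^- (k + s).+1 = (pr ^+ (k + s).+1 - 1) / pr ^+ (k + s).+1.
    by rewrite mulrBl mul1r divff // expf_neq0 ?pr_neq0.
  have -> : legendre_coef n k / ((pr ^+ (k + s).+1 - 1) / pr ^+ (k + s).+1) =
     (-1) ^+ k * gbr n k * pr ^+ 'C(k, 2) * pr ^- (n * k) * D.[pr ^+ k] * pr ^+ (k + s).+1 / F n.
    rewrite /legendre_coef gauss_binomial_shiftE -gauss_binomial_shift -DE.
    have := qfact_neq0 n; have := expf_neq0 (k + s).+1 pr_neq0.
    have := expf_neq0 (n * k) pr_neq0.
    by move: hz; move: (pr ^+ (k + s).+1) (F n) (pr ^+ (n * k)) => a b c ? ? ? ?; field; apply/and4P.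
  rewrite (horner_coef_wide _ sizeD) mulr_sumr !mulr_suml; apply: eq_bigr => r _.
  rewrite exprMn exprVn -!exprM -addnS exprD [(r.+1 * k)%N]mulSn exprD [(k * r)%N]mulnC; ring.
under eq_bigr => k _ do rewrite term.
rewrite exchange_big big1 // => r _ /=.
rewrite -mulr_sumr qbinomial_theorem.
(* The numerator [p ^ (k + s).+1] contributes an extra [p ^ k], which shifts the exponent [r] to
   [r.+1]; [1 <= r.+1 <= n] is exactly what makes a factor vanish. *)
have i_lt : (n - r.+1 < n)%N by have := ltn_ord r; lia.
rewrite (bigD1 (Ordinal i_lt)) //= -[X in 1 - X]mulrA -exprD.
rewrite subnKC // mulVf ?expf_neq0 ?pr_neq0 // subrr mul0r mulr0 //.
Qed.

(** The absolute value of the [k]-th term of [P_n(p ^ n)]. *)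
Definition legendre_term n k : R := gbr n k * gbr (n + k)%N n * pr ^+ 'C(k, 2).

Lemma legendre_term_fact n k : (k <= n)%N ->
  legendre_term n k * (F k ^+ 2 * F (n - k)) = F (n + k) * pr ^+ 'C(k, 2).
Proof.
move=> kn; rewrite /legendre_term.
have e1 := gauss_binomial_fact (n - k) k; rewrite subnK // in e1.
have e2 : gbr (n + k)%N n * (F n * F k) = F (n + k).
  by rewrite addnC gauss_binomial_fact.
by rewrite -e2 -e1; ring.
Qed.

(** The ratio of consecutive terms is [p ^ k (p ^ (n - k) - 1) (p ^ (n + k).+1 - 1) / (p ^ k.+1 - 1)
    ^ 2]. Its being at least 2 lets the last term dominate the alternating sum. *)
Lemma legendre_termS n k : (k < n)%N ->
  2 * legendre_term n k <= legendre_term n k.+1.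
Proof.
move=> kn.
have t0 : 0 <= legendre_term n k by rewrite /legendre_term !mulr_ge0 ?ler0n ?exprn_ge0 ?ler0n.
have e : legendre_term n k.+1 * (pr ^+ k.+1 - 1) ^+ 2 =
    legendre_term n k * (pr ^+ k * (pr ^+ (n - k) - 1) * (pr ^+ (n + k).+1 - 1)).
  have := legendre_term_fact _ _ (ltnW kn); have := legendre_term_fact _ _ kn.
  rewrite addnS (qfactS k) (qfactS (n + k)) binS bin1 exprD -(subnSK kn) (qfactS (n - k.+1)).
  move=> e1 e2; apply: (@mulIf _ (F k ^+ 2 * F (n - k.+1))).
    by rewrite mulf_neq0 ?expf_neq0 ?qfact_neq0.
  rewrite [LHS](_ : _ = legendre_term n k.+1 *
    ((F k * (pr ^+ k.+1 - 1)) ^+ 2 * F (n - k.+1))); last by ring.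
  rewrite e1 [LHS](_ : _ = (F (n + k) * pr ^+ 'C(k, 2)) *
    (pr ^+ (n + k).+1 - 1) * pr ^+ k); last by ring.
  by rewrite -e2; ring.
have d0 : 0 < (pr ^+ k.+1 - 1) ^+ 2 by rewrite exprn_gt0 // subr_gt0 exprSp_gt1.
rewrite -(ler_pM2r d0) e mulrAC [leLHS]mulrC; apply: ler_wpM2l => //.
rewrite [pr ^+ (n + k).+1](_ : _ = pr ^+ (n - k.+1) * pr * (pr * pr ^+ k ^+ 2)); last first.
  by rewrite -exprM -exprSr -exprS -exprD; congr (_ ^+ _); lia.
rewrite -(subnSK kn) [pr ^+ k.+1]exprS [pr ^+ (n - k.+1).+1]exprS.
have : 1 <= pr ^+ k by rewrite exprn_ege1 // ltW // pr_gt1.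
have : 1 <= pr ^+ (n - k.+1) by rewrite exprn_ege1 // ltW // pr_gt1.
have : 2 <= pr by rewrite ler_nat.
move: (pr : R) (pr ^+ k) (pr ^+ (n - k.+1)) => P a b P2 b1 a1.
(* Here [a = p ^ k] and [b = p ^ (n - k.+1)]. For [b = 1] the claim is [h1] multiplied by
   [P * a - 1]; [h3] and [h4] extend it to [b >= 1] by monotonicity. *)
have h1 : 2 * (P * a - 1) <= a * (P - 1) * (P * a + 1).
  rewrite -subr_ge0.
  have P0 : 0 <= P - 2 by rewrite subr_ge0.
  have a0 : 0 <= a - 1 by rewrite subr_ge0.
  have -> : P = P - 2 + 2 by ring.
  have -> : a = a - 1 + 1 by ring.
  move: (P - 2) (a - 1) P0 a0 => d f d0' f0.
  have df := mulr_ge0 d0' f0.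
  have := mulr_ge0 d0' d0'; have := mulr_ge0 f0 f0.
  have := mulr_ge0 df df; have := mulr_ge0 df f0; have := mulr_ge0 df d0'; lra.
have h2 : 2 * (P * a - 1) * (P * a - 1) <= a * (P - 1) * (P * a + 1) * (P * a - 1).
  by apply: ler_wpM2r => //; nra.
have h3 : P - 1 <= P * b - 1 by nra.
have h4 : (P * a + 1) * (P * a - 1) <= b * P * (P * (a * a)) - 1.
  have : 0 <= (b - 1) * (P * (a * (P * a))) by rewrite !mulr_ge0 //; lra.
  by lra.
have h5 : (P - 1) * ((P * a + 1) * (P * a - 1)) <= (P * b - 1) * (b * P * (P * (a * a)) - 1).
  by apply: ler_pM => //; nra.
rewrite expr2 (_ : 2 * _ = 2 * (P * a - 1) * (P * a - 1)); last by ring.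
apply: le_trans h2 _.
rewrite [leLHS](_ : _ = a * ((P - 1) * ((P * a + 1) * (P * a - 1)))); last by ring.
rewrite -[leRHS]mulrA [a ^+ 2]expr2; apply: ler_wpM2l => //; lra.
Qed.

(** Each signed sum is the new term minus the previous signed sum. *)
Lemma alternating_sum_bounds (t : nat -> R) n : 0 <= t 0 ->
  (forall k, (k < n)%N -> t k <= t k.+1) ->
  0 <= (-1) ^+ n * \sum_(k < n.+1) (-1) ^+ k * t k <= t n.
Proof.
move=> t0; elim: n => [|n IH] tS; first by rewrite big_ord1 !mul1r lexx t0.
have /andP[l u] := IH (fun k kn => tS k (ltnW kn)).
rewrite big_ord_recr /= mulrDr !mulrA -expr2 sqrr_sign mul1r exprS -mulrA mulN1r.
by have := tS n (ltnSn n); lra.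
Qed.

(** The signed sum of the terms before the last is at most the last but one, hence at most half of
    the last. *)
Lemma legendre_pn_bounds n : (0 < n)%N ->
  legendre_term n n / 2 <= (-1) ^+ n * \sum_(k < n.+1) legendre_coef n k * (pr ^+ n) ^+ k <= legendre_term n n.
Proof.
case: n => // n _.
have -> : \sum_(k < n.+2) legendre_coef n.+1 k * (pr ^+ n.+1) ^+ k =
   \sum_(k < n.+2) (-1) ^+ k * legendre_term n.+1 k.
  apply: eq_bigr => k _; rewrite -[pr ^+ n.+1]mulr1 legendre_coefX expr1n /legendre_term; ring.
have t0 k : 0 <= legendre_term n.+1 k by rewrite /legendre_term !mulr_ge0 ?ler0n ?exprn_ge0 ?ler0n.
have : 0 <= (-1) ^+ n * \sum_(k < n.+1) (-1) ^+ k * legendre_term n.+1 k <= legendre_term n.+1 n.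
  apply: alternating_sum_bounds => // k kn.
  by have := legendre_termS n.+1 k (ltnW kn); have := t0 k; lra.
have tS := legendre_termS _ _ (ltnSn n).
rewrite [in X in _ -> X]big_ord_recr; set S := bigop _ _ _.
rewrite (_ : (-1) ^+ n.+1 * _ = legendre_term n.+1 n.+1 - (-1) ^+ n * S); last first.
  rewrite mulrDr mulrA -expr2 sqrr_sign mul1r exprS; ring.
by lra.
Qed.

Lemma legendre_termnn_bounds n :
  pr ^+ (n * n + 'C(n, 2)) <= legendre_term n n <= 2 ^+ n * pr ^+ (n * n + 'C(n, 2)).
Proof.
rewrite /legendre_term gauss_binomialnn mul1r exprD mulrA.
by rewrite !ler_pM2r ?prX_gt0 // gauss_binomial_bounds.
Qed.

End GaussBinomial.

(** * The polynomials [P_n] and [Q_n] at [q = 1/p] *)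

Section LittleLegendre.
Variables (R : realType) (p : nat).
Hypothesis p_gt1 : (1 < p)%N.
Local Notation pr := (p%:R : R).
Local Notation F := (@qfact R p).
Local Notation c := (@legendre_coef R p).
Local Notation P := (@little_qLegendre R (pr^-1)).

Lemma qpoch_desc m k : qpoch ((pr^-1) ^- (m + k)) pr^-1 k * F m = (-1) ^+ k * F (m + k).
Proof.
rewrite /qpoch; elim: k => [|k IH]; first by rewrite big_ord0 addn0 !mul1r.
have -> : \prod_(i < k.+1) (1 - (pr^-1) ^- (m + k.+1) * pr^-1 ^+ i) =
   (1 - pr ^+ (m + k).+1) * \prod_(i < k) (1 - (pr^-1) ^- (m + k) * pr^-1 ^+ i).
  rewrite big_ord_recl /= expr0 mulr1 exprVn invrK addnS; congr (_ * _).
  apply: eq_bigr => i _; rewrite /bump add1n !exprVn !invrK exprSr exprS invfM mulrA mulrK //.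
  by rewrite unitfE pr_neq0.
by rewrite -mulrA IH addnS qfactS [(-1) ^+ k.+1]exprS; ring.
Qed.

Lemma qpoch_asc n k :
  qpoch ((pr^-1) ^+ n.+1) pr^-1 k * (pr ^+ (n * k + 'C(k.+1, 2)) * F n) = F (n + k).
Proof.
rewrite /qpoch; elim: k => [|k IH].
  by rewrite big_ord0 muln0 addn0 !mul1r.
rewrite big_ord_recr /= binS bin1 mulnS.
rewrite [(n + k.+1)%N]addnS qfactS -IH -exprD.
move: (\prod_(i < k) _) => T; rewrite exprVn.
rewrite [(n + n * k + _)%N](_ : _ = (n * k + 'C(k.+1, 2)) + (n + k).+1)%N; last by lia.
rewrite [pr ^+ (_ + _ + _)]exprD addSn.
have := expf_neq0 (n + k).+1 (pr_neq0 R p p_gt1).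
by move: (pr ^+ (n + k).+1) => a a0; field.
Qed.

Lemma little_qLegendre_coefE n k : (k <= n)%N ->
  (qpoch ((pr^-1) ^- n) pr^-1 k * qpoch ((pr^-1) ^+ n.+1) pr^-1 k)
    / (qpoch pr^-1 pr^-1 k * qpoch pr^-1 pr^-1 k) * pr^-1 ^+ k = c n k.
Proof.
move=> kn.
have e1 := qpoch_desc (n - k) k; rewrite subnK // in e1.
have e2 := qpoch_asc n k.
(* The case [n = 0] is [(q;q)_k]. *)
have e3 := qpoch_asc 0 k; rewrite expr1 mul0n !add0n /qfact big_ord0 mulr1 -/(F k) in e3.
have e4 := gauss_binomial_fact R p (n - k) k; rewrite subnK // in e4.
have e5 : (gauss_binomial p (n + k) n)%:R * (F n * F k) = F (n + k).
  by rewrite addnC gauss_binomial_fact.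
rewrite /legendre_coef [_^-1 ^+ k in LHS]exprVn.
have Fk : F k != 0 by rewrite qfact_neq0.
have Fn : F n != 0 by rewrite qfact_neq0.
have Fnk : F (n - k) != 0 by rewrite qfact_neq0.
have := expf_neq0 k (pr_neq0 R p p_gt1); have := expf_neq0 'C(k, 2) (pr_neq0 R p p_gt1).
have := expf_neq0 (n * k) (pr_neq0 R p p_gt1).
rewrite binS bin1 !exprD in e2 e3.
move=> pnk pC pk.
have -> : qpoch (pr^-1 ^- n) pr^-1 k = (-1) ^+ k * (gauss_binomial p n k)%:R * F k.
  by apply: (mulIf Fnk); rewrite e1 -e4; ring.
have -> : qpoch (pr^-1 ^+ n.+1) pr^-1 k =
   (gauss_binomial p (n + k) n)%:R * F k / (pr ^+ (n * k) * pr ^+ 'C(k, 2) * pr ^+ k).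
  have H : pr ^+ (n * k) * (pr ^+ 'C(k, 2) * pr ^+ k) * F n != 0 by rewrite !mulf_neq0.
  by apply: (mulIf H); rewrite e2 -e5; field; apply/and3P.
have -> : qpoch pr^-1 pr^-1 k = F k / (pr ^+ 'C(k, 2) * pr ^+ k).
  have H : pr ^+ 'C(k, 2) * pr ^+ k != 0 by rewrite !mulf_neq0.
  by apply: (mulIf H); rewrite e3; field; apply/andP.
by field; apply/and4P.
Qed.

Lemma horner_little_qLegendre n x :
  (P n).[x] = \sum_(k < n.+1) c n k * x ^+ k.
Proof.
rewrite /little_qLegendre horner_sum; apply: eq_bigr => k _.
by rewrite hornerZ hornerXn little_qLegendre_coefE // -ltnS.
Qed.

Lemma geometric_cvg (r : nat) :
  (fun N => \sum_(0 <= j < N) pr ^- j * (pr ^- j) ^+ r) @ \oo --> (1 - pr ^- r.+1)^-1.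
Proof.
have h1 : pr ^- r.+1 < 1 by rewrite invf_lt1 ?prX_gt0 // exprSp_gt1.
rewrite (_ : (fun N => _) = series (geometric 1 (pr ^- r.+1))).
  rewrite -[X in _ --> X]mul1r; apply: cvg_geometric_series.
  by rewrite gtr0_norm // prV_gt0.
apply/funext => N; rewrite /series /=; apply: eq_bigr => j _.
by rewrite mul1r -exprS -!exprVn -!exprM mulnC.
Qed.

(** The quotient [(P_n(x) - P_n(y)) / (x - y)] as an explicit polynomial in both variables: sums
    over [y = q ^ j] can be taken monomial by monomial, and the degree in [y] is visibly below
    [n]. *)
Definition diff_quot (n : nat) (x y : R) : R :=
  \sum_(k < n.+1) c n k * \sum_(i < k) x ^+ (k.-1 - i) * y ^+ i.

Lemma diff_quotP n x y : (P n).[x] - (P n).[y] = (x - y) * diff_quot n x y.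
Proof.
rewrite !horner_little_qLegendre -sumrB /diff_quot mulr_sumr; apply: eq_bigr => k _.
by rewrite -mulrBr subrXX mulrCA.
Qed.

Lemma expV_neq_pn n j : (0 < n)%N -> pr ^+ n != pr ^- j.
Proof.
case: n => // n _; rewrite gt_eqF //; apply: le_lt_trans (exprSp_gt1 R p p_gt1 n).
by rewrite -[leRHS]invr1 -(expr0 pr) prV_le.
Qed.

(** [Q_n(p ^ n)] after summing the geometric series in [j] for each monomial of [diff_quot]. *)
Definition legendre_assoc_sum (n : nat) : R :=
  \sum_(k < n.+1) c n k * \sum_(i < k) pr ^+ n ^+ (k.-1 - i) * (1 - pr ^- i.+1)^-1.

Lemma legendre_assoc_cvg n : (0 < n)%N ->
  (fun N => \sum_(0 <= j < N) (diff_quot n (pr ^+ n) (pr ^- j) * pr ^- j)) @ \oo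
    --> legendre_assoc_sum n.
Proof.
move=> n0.
rewrite (_ : (fun N => _) = (fun N => \sum_(k < n.+1) c n k *
  \sum_(i < k) pr ^+ n ^+ (k.-1 - i) * \sum_(0 <= j < N) pr ^- j * (pr ^- j) ^+ i)); last first.
  apply/funext => N; rewrite /diff_quot.
  under eq_bigr => j _ do rewrite mulr_suml.
  rewrite exchange_big /=; apply: eq_bigr => k _.
  under eq_bigr => j _ do rewrite -mulrA mulr_suml.
  rewrite -mulr_sumr; congr (_ * _); rewrite exchange_big /=; apply: eq_bigr => i _.
  by rewrite mulr_sumr; apply: eq_bigr => j _; rewrite -mulrA [_ * pr ^- j]mulrC.
apply: (cvg_big (op := +%R)) => [|k _]; first exact: add_continuous; apply: cvgMl_tmp; apply: (cvg_big (op := +%R)) => [|i _]; first exact: add_continuous; apply: cvgMr.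
exact: geometric_cvg.
Qed.

Lemma little_qLegendre_assocE n : (0 < n)%N ->
  little_qLegendre_assoc pr^-1 n (pr ^+ n) = legendre_assoc_sum n.
Proof.
move=> n0; rewrite /little_qLegendre_assoc; apply: cvg_lim => //.
rewrite (_ : (fun N => _) = (fun N => \sum_(0 <= j < N)
  (diff_quot n (pr ^+ n) (pr ^- j) * pr ^- j))); first exact: legendre_assoc_cvg.
apply/funext => N; apply: eq_bigr => j _; rewrite exprVn; congr (_ * _).
have hx : pr ^+ n - pr ^- j != 0 by rewrite subr_eq0 expV_neq_pn.
apply: (mulfI hx); rewrite -diff_quotP.
have dvd : ('X - (pr ^- j)%:P) %| (P n - (P n).[pr ^- j]%:P).
  by rewrite dvdp_XsubCl /root !hornerE subrr.
by rewrite -[in RHS](hornerC (P n).[pr ^- j] (pr ^+ n)) -hornerN -hornerD -{2}(divpK dvd) hornerM !hornerE mulrC.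
Qed.

(** * The tail of [h] and the remainder [R_n] *)

Definition harmonic_sum (N : nat) : R := \sum_(1 <= k < N) (pr ^+ k - 1)^-1.

Lemma harmonic_term_ge0 k : 0 <= (pr ^+ k - 1)^-1.
Proof. by rewrite invr_ge0 subr_ge0 exprn_ege1 // ler1n ltnW. Qed.

Lemma harmonic_sumS N : (0 < N)%N -> harmonic_sum N.+1 = harmonic_sum N + (pr ^+ N - 1)^-1.
Proof. by move=> N0; rewrite /harmonic_sum big_nat_recr. Qed.

(** Since [p ^ k - 1 >= 2 ^ k / 2], the terms are at most [2 * 2 ^- k]; the bound serves only for
    convergence. *)
Lemma harmonic_sum_le N : harmonic_sum N <= 4 - 4 * 2 ^- N.
Proof.
elim: N => [|[|N] IH].
- by rewrite /harmonic_sum big_geq // expr0 invr1; lra.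
- by rewrite /harmonic_sum big_geq // expr1; lra.
rewrite harmonic_sumS //.
have : (pr ^+ N.+1 - 1)^-1 <= 2 * 2 ^- N.+1.
  have p2 : (2 : R) ^+ N.+1 <= pr ^+ N.+1 by rewrite lerXn2r ?nnegrE ?ler0n // ler_nat.
  have two : 2 <= (2 : R) ^+ N.+1 by rewrite exprS ler_peMr // exprn_ege1 // ler1n.
  rewrite -[X in X * _](invrK 2) -invfM lef_pV2 ?posrE; first by lra.
    by lra.
  by rewrite mulr_gt0 // exprn_gt0.
rewrite [2 ^+ N.+2]exprS invfM; move: IH; set u := harmonic_sum _; set v := 2 ^- N.+1.
lra.
Qed.

Lemma harmonic_sum_cvg : harmonic_sum @ \oo --> qharmonic R p.
Proof.
have : cvgn harmonic_sum; last by [].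
apply: nondecreasing_is_cvgn.
  apply/nondecreasing_seqP => -[|N].
    by rewrite /harmonic_sum !big_geq.
  by rewrite [leRHS]harmonic_sumS // lerDl harmonic_term_ge0.
exists 4 => _ [N _ <-]; apply: le_trans (harmonic_sum_le N) _.
by rewrite lerBlDr lerDl mulr_ge0 // invr_ge0 exprn_ge0.
Qed.

(** As [1 / (p ^ (n + j) - 1) = q ^ j / (p ^ n - q ^ j)], the tail is the Stieltjes transform at
    [p ^ n] of the measure with mass [q ^ j] at [q ^ j], for which the [P_n] are orthogonal. *)
Lemma harmonic_tail n N : (0 < n)%N ->
  harmonic_sum (n + N) - harmonic_sum n =
  \sum_(0 <= j < N) pr ^- j / (pr ^+ n - pr ^- j).
Proof.
move=> n0; elim: N => [|N IH]; first by rewrite addn0 subrr big_geq.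
rewrite addnS harmonic_sumS ?addn_gt0 ?n0 // big_nat_recr //= -IH.
rewrite addrAC; congr (_ + _).
have h3 := expf_neq0 N (pr_neq0 R p p_gt1).
have -> : pr ^+ n - pr ^- N = (pr ^+ (n + N) - 1) / pr ^+ N.
  by rewrite exprD mulrBl mul1r mulfK.
by rewrite invf_div mulKf.
Qed.

Lemma harmonic_tail_cvg n : (0 < n)%N ->
  (fun N => \sum_(0 <= j < N) pr ^- j / (pr ^+ n - pr ^- j)) @ \oo -->
  qharmonic R p - harmonic_sum n.
Proof.
move=> n0; rewrite (_ : (fun N => _) = (fun N => harmonic_sum (n + N) - harmonic_sum n)).
  apply: cvgB; last exact: cvg_cst.
  under eq_fun do rewrite addnC.
  by have := harmonic_sum_cvg; rewrite -(cvg_shiftn n harmonic_sum).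
by apply/funext => N; rewrite harmonic_tail.
Qed.

Definition legendre_remainder (n : nat) : R :=
  (P n).[pr ^+ n] * (qharmonic R p - harmonic_sum n) - legendre_assoc_sum n.

Lemma legendre_remainder_cvg n : (0 < n)%N ->
  (fun N => \sum_(0 <= j < N) (P n).[pr ^- j] * (pr ^- j / (pr ^+ n - pr ^- j))) @ \oo -->
  legendre_remainder n.
Proof.
move=> n0.
rewrite (_ : (fun N => _) = (fun N => (P n).[pr ^+ n] *
   (\sum_(0 <= j < N) pr ^- j / (pr ^+ n - pr ^- j)) -
   \sum_(0 <= j < N) (diff_quot n (pr ^+ n) (pr ^- j) * pr ^- j))).
  apply: cvgB; last exact: legendre_assoc_cvg.
  apply: cvgMl_tmp; exact: harmonic_tail_cvg.
apply/funext => N; rewrite mulr_sumr -sumrB; apply: eq_bigr => j _.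
have h1 : pr ^+ n - pr ^- j != 0 by rewrite subr_eq0 expV_neq_pn.
have := diff_quotP n (pr ^+ n) (pr ^- j).
move/(congr1 (fun z => z + (P n).[pr ^- j])); rewrite subrK => ->.
by move: (pr ^+ n - pr ^- j) (pr ^- j) h1 => z y h1; field.
Qed.

Lemma legendre_moment_cvg n s : (s < n)%N ->
  (fun N => \sum_(0 <= j < N) (P n).[pr ^- j] * (pr ^- j * (pr ^- j) ^+ s)) @ \oo --> (0 : R).
Proof.
move=> sn; rewrite -[X in _ --> X](legendre_orthogonal R p p_gt1 n s sn).
rewrite (_ : (fun N => _) = (fun N => \sum_(k < n.+1) c n k *
   \sum_(0 <= j < N) pr ^- j * (pr ^- j) ^+ (k + s))).
  apply: (cvg_big (op := +%R)) => [|k _]; first exact: add_continuous.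
  by apply: cvgMl_tmp; exact: geometric_cvg.
apply/funext => N.
under eq_bigr => j _ do rewrite horner_little_qLegendre mulr_suml.
rewrite exchange_big /=; apply: eq_bigr => k _; rewrite mulr_sumr.
by apply: eq_bigr => j _; rewrite exprD; ring.
Qed.

(* Orthogonality replaces one factor P(x) by P(q^j), which makes the terms nonnegative. *)
Lemma legendre_square_cvg n : (0 < n)%N ->
  (fun N => \sum_(0 <= j < N) (P n).[pr ^- j] ^+ 2 * (pr ^- j / (pr ^+ n - pr ^- j))) @ \oo -->
  (P n).[pr ^+ n] * legendre_remainder n.
Proof.
move=> n0.
rewrite (_ : (fun N => _) = (fun N => (P n).[pr ^+ n] *
   (\sum_(0 <= j < N) (P n).[pr ^- j] * (pr ^- j / (pr ^+ n - pr ^- j))) -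
   \sum_(k < n.+1) c n k * \sum_(i < k) pr ^+ n ^+ (k.-1 - i) *
     \sum_(0 <= j < N) (P n).[pr ^- j] * (pr ^- j * (pr ^- j) ^+ i))).
  rewrite -[X in _ --> X]subr0; apply: cvgB.
    by apply: cvgMl_tmp; exact: legendre_remainder_cvg.
  rewrite [X in _ --> X](_ : 0 = \sum_(k < n.+1) c n k * \sum_(i < k) pr ^+ n ^+ (k.-1 - i) * 0).
    apply: (cvg_big (op := +%R)) => [|k _]; first exact: add_continuous.
    apply: cvgMl_tmp; apply: (cvg_big (op := +%R)) => [|i _]; first exact: add_continuous.
    apply: cvgMl_tmp; apply: legendre_moment_cvg.
    exact: leq_trans (ltn_ord i) (leq_ord k).
  by rewrite big1 // => k _; rewrite big1 ?mulr0 // => i _; rewrite mulr0.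
apply/funext => N.
have -> : \sum_(k < n.+1) c n k * \sum_(i < k) pr ^+ n ^+ (k.-1 - i) *
     \sum_(0 <= j < N) (P n).[pr ^- j] * (pr ^- j * (pr ^- j) ^+ i) =
   \sum_(0 <= j < N) (P n).[pr ^- j] * (pr ^- j * diff_quot n (pr ^+ n) (pr ^- j)).
  under [in RHS]eq_bigr => j _ do rewrite /diff_quot !mulr_sumr.
  rewrite [in RHS]exchange_big /=; apply: eq_bigr => k _.
  under [in RHS]eq_bigr => j _ do rewrite !mulr_sumr.
  rewrite [in RHS]exchange_big /= mulr_sumr; apply: eq_bigr => i _.
  by rewrite !mulr_sumr; apply: eq_bigr => j _; ring.
rewrite mulr_sumr -sumrB; apply: eq_bigr => j _.
have h1 : pr ^+ n - pr ^- j != 0 by rewrite subr_eq0 expV_neq_pn.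
have := diff_quotP n (pr ^+ n) (pr ^- j).
move/(congr1 (fun z => z + (P n).[pr ^- j])); rewrite subrK => ->.
by move: (pr ^+ n - pr ^- j) (pr ^- j) h1 => z y h1; field.
Qed.

Lemma legendre_weight n j : (0 < n)%N ->
  pr ^- n * pr ^- j <= pr ^- j / (pr ^+ n - pr ^- j) <= pr ^- j.
Proof.
move=> n0; have x1 : pr ^- j <= 1 by rewrite -[leRHS]invr1 -(expr0 pr) prV_le.
have x0 := prV_gt0 R p p_gt1 j.
have pn2 : 2 <= pr ^+ n.
  rewrite -natrX ler_nat (leq_trans p_gt1) //.
  by rewrite -[leqLHS]expn1 leq_exp2l.
apply/andP; split.
  rewrite mulrC ler_pM2l // lef_pV2 ?posrE ?prX_gt0 //; last by lra.
  by rewrite lerBlDr lerDl ltW.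
by rewrite ler_pdivrMr; [rewrite ler_pMr //; lra | lra].
Qed.

(** All terms of the series of squares are nonnegative. The lower bound keeps only [j = 3 * n + 1],
    the first index at which [P_n(q ^ j) >= 1 / 2] is available; the upper bound combines
    [|P_n(q ^ j)| <= 3 ^ n] with [\sum_j q ^ j <= 2]. *)
Lemma legendre_remainder_bounds n : (0 < n)%N ->
  1 / 4 * pr ^- (n + (3 * n).+1) <= (P n).[pr ^+ n] * legendre_remainder n <= 2 * 9 ^+ n.
Proof.
move=> n0.
have cv := legendre_square_cvg n n0.
have t0 j : 0 <= (P n).[pr ^- j] ^+ 2 * (pr ^- j / (pr ^+ n - pr ^- j)).
  have /andP[l _] := legendre_weight n j n0.
  rewrite mulr_ge0 ?sqr_ge0 // (le_trans _ l) // mulr_ge0 // ltW // prV_gt0 //.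
apply/andP; split.
  rewrite -(cvg_lim _ cv) //; apply: limr_ge; first by apply/cvg_ex; eexists; exact: cv.
  exists (3 * n).+2 => // N /= nN.
  rewrite (big_cat_nat (n := (3 * n).+1)) //=; last by apply: ltnW; apply: leq_trans nN.
  rewrite (big_ltn (m := (3 * n).+1)) //.
  have /andP[l _] := legendre_weight n (3 * n).+1 n0.
  have near1 : 1 / 4 <= (P n).[pr ^- (3 * n).+1] ^+ 2.
    have := legendre_at_expV_near1 R p p_gt1 n (3 * n).+1 (ltnSn _).
    by rewrite -horner_little_qLegendre => ?; rewrite expr2; nra.
  apply: le_trans (_ : (P n).[pr ^- (3 * n).+1] ^+ 2 * (pr ^- (3 * n).+1 / (pr ^+ n - pr ^- (3 * n).+1)) <= _).
    have q4 : 0 <= 1 / 4 :> R by lra.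
    apply: ler_pM => //; rewrite ?(ltW (prV_gt0 R p p_gt1 _)) //.
    by rewrite exprD invfM.
  by rewrite [leRHS]addrCA lerDl addr_ge0 // sumr_ge0.
rewrite -(cvg_lim _ cv) //; apply: limr_le; first by apply/cvg_ex; eexists; exact: cv.
near=> N.
apply: (@le_trans _ _ (\sum_(0 <= j < N) 9 ^+ n * pr ^- j)).
  apply: ler_sum => j _.
  have /andP[l u] := legendre_weight n j n0.
  apply: ler_pM => //; first exact: sqr_ge0.
    by rewrite (le_trans _ l) // mulr_ge0 // ltW // prV_gt0.
  have := legendre_at_expV_bound R p p_gt1 n j; rewrite -horner_little_qLegendre.
  move=> h; rewrite -real_normK ?num_real // (_ : 9 = 3 * 3); last by ring.
  by rewrite exprMn expr2; apply: ler_pM.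
rewrite -mulr_sumr mulrC ler_pM2r ?exprn_gt0 //.
have : \sum_(0 <= j < N) pr ^- j <= 2 - 2 * 2 ^- N.
  elim: (N) => [|M IH]; first by rewrite big_geq // expr0 invr1; lra.
  rewrite big_nat_recr //=.
  have : pr ^- M <= 2 ^- M.
    rewrite lef_pV2 ?posrE ?prX_gt0 ?exprn_gt0 //.
    by rewrite lerXn2r ?nnegrE ?ler0n // ler_nat.
  by rewrite [2 ^+ M.+1]exprS invfM; lra.
by move=> /le_trans; apply; rewrite lerBlDr lerDl mulr_ge0 // invr_ge0 exprn_ge0.
Unshelve. all: by end_near.
Qed.

(** * Integrality of [a_n] and [b_n], and signs *)

Lemma exprB1_neq0 m : pr ^+ m.+1 - 1 != 0.
Proof. by rewrite subr_eq0 gt_eqF // exprSp_gt1. Qed.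

(* Removing the powers of [p] in the denominators of [Q_n] produces the values
   of [P_n] at the lower powers of [p]. *)
Lemma legendre_assoc_decomp n : (0 < n)%N ->
  legendre_assoc_sum n + (P n).[pr ^+ n] * harmonic_sum n =
  \sum_(k < n.+1) c n k * (pr ^+ n) ^+ k * \sum_(i < k) (pr ^+ i.+1 - 1)^-1 +
  \sum_(1 <= j < n) (P n).[pr ^+ (n - j)] * (pr ^+ j - 1)^-1.
Proof.
move=> n0.
have pX0 m : pr ^+ m != 0 by rewrite expf_neq0 // pr_neq0.
(* Separates the denominator [p ^ m.+1 - 1] from the powers of [p]. Summed over [i] by [geom2], the
   powers become [(1 - p ^- (j * k)) / (p ^ j - 1)], that is, the difference
   [P_n(p ^ n) - P_n(p ^ (n - j))] after summing over [k]; its first part cancels against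
   [harmonic_sum n]. *)
have geom m : pr ^- (n.-1 * m.+1) * (pr ^+ m.+1 - 1)^-1 =
    (pr ^+ m.+1 - 1)^-1 - \sum_(1 <= j < n) pr ^- (j * m.+1).
  have h := exprB1_neq0 m.
  case: (n) n0 => // N _ /=; elim: N => [|N IH].
    by rewrite big_geq // subr0 mul0n expr0 invr1 mul1r.
  rewrite big_nat_recr //= opprD addrA -IH mulSn exprD.
  have := pX0 m.+1; have := pX0 (N * m.+1)%N.
  by move: h; move: (pr ^+ m.+1) (pr ^+ (N * m.+1)) => a b ? ? ?; field; apply/and3P.
have geom2 j k : (0 < j)%N -> \sum_(i < k) pr ^- (j * i.+1) = (1 - pr ^- (j * k)) * (pr ^+ j - 1)^-1.
  case: j => // j _; elim: k => [|k IH].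
    by rewrite big_ord0 muln0 expr0 invr1 subrr mul0r.
  rewrite big_ord_recr /= IH mulnS exprD.
  have := exprB1_neq0 j; have := pX0 j.+1; have := pX0 (j.+1 * k)%N.
  by move: (pr ^+ j.+1) (pr ^+ (j.+1 * k)) => a b ? ? ?; field; apply/and3P.
have -> : legendre_assoc_sum n =
  \sum_(k < n.+1) c n k * (pr ^+ n) ^+ k * \sum_(i < k) (pr ^+ i.+1 - 1)^-1 -
  \sum_(1 <= j < n) \sum_(k < n.+1) c n k * (pr ^+ n) ^+ k * \sum_(i < k) pr ^- (j * i.+1).
  rewrite exchange_big -sumrB /legendre_assoc_sum; apply: eq_bigr => k _.
  rewrite -mulr_sumr -mulrBr -[RHS]mulrA; congr (_ * _).
  rewrite exchange_big -sumrB mulr_sumr; apply: eq_bigr => i _.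
  rewrite -geom (_ : pr ^+ n ^+ (k.-1 - i) = pr ^+ n ^+ k * pr ^- (n * i.+1)); last first.
    apply: (mulIf (pX0 (n * i.+1)%N)); rewrite mulfVK // -!exprM -exprD -mulnDr.
    by congr (pr ^+ (n * _)); have := ltn_ord i; lia.
  rewrite -mulrA; congr (_ * _).
  rewrite [in LHS](_ : (n * i.+1)%N = n.-1 * i.+1 + i.+1)%N; last by rewrite -[X in (X * _)%N = _](prednK n0) mulSn addnC.
  rewrite exprD; have := exprB1_neq0 i; have := pX0 i.+1; have := pX0 (n.-1 * i.+1)%N.
  by move: (pr ^+ i.+1) (pr ^+ (n.-1 * i.+1)) => a b ? ? ?; field; apply/and3P.
rewrite -addrA; congr (_ + _).
rewrite /harmonic_sum mulr_sumr addrC -sumrB big_nat [in RHS]big_nat.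
apply: eq_bigr => j /andP[j1 jn].
under eq_bigr => k _ do rewrite geom2 // mulrA.
rewrite -mulr_suml -mulrBl; congr (_ * _).
rewrite !horner_little_qLegendre -sumrB; apply: eq_bigr => k _.
rewrite mulrBr mulr1 opprB addrC subrK -mulrA; congr (_ * _).
apply: (mulIf (pX0 (j * k)%N)); rewrite mulfVK // -!exprM -exprD -mulnDl.
by congr (pr ^+ (_ * _)); lia.
Qed.

(** In the decomposition the numerators [c n k * p ^ (n * k)] and [P_n(p ^ (n - j))], with
    [n - j > 0], are integers, and the denominators are [p ^ m - 1] with [0 < m <= n]. *)
Lemma legendre_assoc_int n (D : R) : (0 < n)%N ->
  (forall m, (0 < m <= n)%N -> D * (pr ^+ m - 1)^-1 \is a Num.int) ->
  D * (legendre_assoc_sum n + (P n).[pr ^+ n] * harmonic_sum n) \is a Num.int.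
Proof.
move=> n0 Dint; rewrite legendre_assoc_decomp // mulrDr !mulr_sumr.
apply: rpredD; first (apply: rpred_sum => k _); last rewrite big_nat; last (apply: rpred_sum => j jn).
  rewrite mulrCA mulr_sumr; apply: rpredM.
    rewrite -[pr ^+ n]mulr1 legendre_coefX // expr1n mulr1.
    by rewrite !rpredM ?rpredX ?rpredN ?rpred1 ?rpred_nat.
  apply: rpred_sum => i _; apply: Dint => /=.
  exact: leq_trans (ltn_ord i) (leq_ord k).
rewrite mulrCA horner_little_qLegendre; apply: rpredM; last first.
  by move/andP: jn => [j1 jn]; apply: Dint; rewrite j1 ltnW.
by apply: legendre_at_int_int => //; move/andP: jn => [j1 jn]; rewrite subn_gt0.
Qed.

(** The product of [Phi_d(p)] over [d] dividing [k] is [p ^ k - 1 > 0], and by strong induction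
    every factor other than that of [d = k] is positive. *)
Lemma cyclotomic_gt0 k : (0 < k)%N -> 0 < ('Phi_k).[p%:Z].
Proof.
elim/ltn_ind: k => k IH k0.
have : 0 < \prod_(d <- divisors k) ('Phi_d).[p%:Z].
  rewrite -horner_prod prod_Cyclotomic // !hornerE subr_gt0.
  by rewrite exprn_egt1 -?lt0n // ltz_nat.
have kk : k \in divisors k by rewrite -dvdn_divisors.
rewrite (big_rem k) //= pmulr_lgt0 // big_seq.
apply: prodr_gt0 => d; rewrite mem_rem_uniq ?divisors_uniq // inE => /andP[dk].
rewrite -dvdn_divisors // => dvd; apply: IH; last exact: dvdn_gt0 dvd.
by rewrite ltn_neqAle dk dvdn_leq.
Qed.

Lemma cyclotomic_prod_gt0 n : 0 < cyclotomic_prod n p%:Z.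
Proof.
rewrite /cyclotomic_prod big_nat; apply: prodr_gt0 => k /andP[k0 _].
exact: cyclotomic_gt0.
Qed.

(** [p ^ m - 1] is the subproduct over the indices dividing [m]. *)
Lemma cyclotomic_prod_dvd n m : (0 < m <= n)%N ->
  (p%:Z ^+ m - 1 %| cyclotomic_prod n p%:Z)%Z.
Proof.
move=> /andP[m0 mn].
have <- : \prod_(1 <= k < n.+1 | (k %| m)%N) ('Phi_k).[p%:Z] = p%:Z ^+ m - 1.
  rewrite -big_filter.
  transitivity (\prod_(d <- divisors m) ('Phi_d).[p%:Z]); last first.
    by rewrite -horner_prod prod_Cyclotomic // !hornerE.
  apply: perm_big; apply: uniq_perm.
  - by rewrite filter_uniq // iota_uniq.
  - exact: divisors_uniq.
  move=> d; rewrite mem_filter mem_index_iota -dvdn_divisors //.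
  case: (boolP (d %| m)%N) => //= dvd.
  by rewrite (dvdn_gt0 m0 dvd) ltnS (leq_trans (dvdn_leq m0 dvd) mn).
by rewrite /cyclotomic_prod (bigID (fun k => (k %| m)%N)) /= dvdz_mulr // dvdzz.
Qed.

Lemma cyclotomic_prod_div_int n m : (0 < m <= n)%N ->
  (cyclotomic_prod n p%:Z)%:~R * (pr ^+ m - 1)^-1 \is a Num.int.
Proof.
move=> mn; have /dvdzP[e ->] := cyclotomic_prod_dvd _ _ mn.
rewrite intrM intrB rmorphXn /= mulfK //.
by case: m mn => // m _; rewrite exprB1_neq0.
Qed.

Lemma approx_remainder n : (0 < n)%N ->
  approx_b R p n * qharmonic R p - approx_a R p n =
  (cyclotomic_prod n p%:Z)%:~R * legendre_remainder n.
Proof.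
move=> n0; rewrite /approx_a little_qLegendre_assocE // /approx_b /legendre_remainder.
by rewrite /harmonic_sum; ring.
Qed.

Lemma approx_a_int n : (0 < n)%N -> approx_a R p n \is a Num.int.
Proof.
move=> n0; rewrite /approx_a little_qLegendre_assocE // /approx_b -mulrA -mulrDr.
by apply: legendre_assoc_int => // m mn; apply: cyclotomic_prod_div_int.
Qed.

Lemma legendre_pn_gt0 n : (0 < n)%N -> 0 < (-1) ^+ n * (P n).[pr ^+ n].
Proof.
move=> n0; rewrite horner_little_qLegendre.
have /andP[l _] := legendre_pn_bounds R p p_gt1 n n0.
have /andP[l' _] := legendre_termnn_bounds R p p_gt1 n.
apply: lt_le_trans l; apply: divr_gt0 => //; apply: lt_le_trans l'.
exact: prX_gt0.
Qed.

Lemma approx_b_gt0 n : (0 < n)%N -> 0 < (-1) ^+ n * approx_b R p n.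
Proof.
move=> n0; rewrite /approx_b mulrCA mulr_gt0 ?legendre_pn_gt0 //.
by rewrite ltr0z cyclotomic_prod_gt0.
Qed.

Lemma approx_b_nat n : (0 < n)%N -> (-1) ^+ n * approx_b R p n \is a Num.nat.
Proof.
move=> n0; rewrite natrEint ltW ?approx_b_gt0 // andbT.
rewrite rpredM ?rpredX ?rpredN ?rpred1 // /approx_b rpredM ?rpred_int //.
by rewrite horner_little_qLegendre legendre_at_int_int.
Qed.

Lemma legendre_remainder_gt0 n : (0 < n)%N -> 0 < (-1) ^+ n * legendre_remainder n.
Proof.
move=> n0; have /andP[l _] := legendre_remainder_bounds n n0.
rewrite -(pmulr_rgt0 _ (legendre_pn_gt0 n n0)) mulrACA -expr2 sqrr_sign mul1r.
by apply: lt_le_trans l; rewrite mulr_gt0 ?prV_gt0 //; lra.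
Qed.

Lemma approx_remainder_gt0 n : (0 < n)%N ->
  0 < (-1) ^+ n * (approx_b R p n * qharmonic R p - approx_a R p n).
Proof.
move=> n0; rewrite approx_remainder // mulrCA mulr_gt0 ?legendre_remainder_gt0 //.
by rewrite ltr0z cyclotomic_prod_gt0.
Qed.

End LittleLegendre.

(** * Sequences that are [o(n^2)], and inversion of sums over [n %/ e] *)

Section QuadraticallySmall.
Variable R : realType.
Implicit Types (f g : nat -> R).

(** This is [f n = o(n ^ 2)]; the additive [C] absorbs initial values and lower-order terms, so that
    no threshold has to be carried along. *)
Definition quad_small f :=
  forall d : R, 0 < d -> exists C : R, forall n, `|f n| <= d * n%:R ^+ 2 + C.

Lemma linear_le_quad (d K : R) n : 0 < d -> K * n%:R <= d * n%:R ^+ 2 + K ^+ 2 / d.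
Proof.
move=> d0; rewrite -(ler_pM2l d0) mulrDr [d * (K ^+ 2 / d)]mulrC mulfVK ?gt_eqF //.
have := sqr_ge0 (d * n%:R - K / 2); have := sqr_ge0 K; rewrite !expr2; lra.
Qed.

Lemma quad_smallD f g : quad_small f -> quad_small g -> quad_small (fun n => f n + g n).
Proof.
move=> hf hg d d0; have d2 : 0 < d / 2 by rewrite divr_gt0.
have [C hC] := hf _ d2; have [C' hC'] := hg _ d2.
exists (C + C') => n; apply: le_trans (ler_normD _ _) _.
by have := hC n; have := hC' n; lra.
Qed.

Lemma quad_smallM (k : R) f : quad_small f -> quad_small (fun n => k * f n).
Proof.
move=> hf d d0; have k0 : 0 < `|k| + 1 by rewrite ltr_wpDl.
have [C hC] := hf _ (divr_gt0 d0 k0).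
exists ((`|k| + 1) * C) => n; rewrite normrM.
apply: (@le_trans _ _ ((`|k| + 1) * `|f n|)); first by rewrite ler_wpM2r // lerDl.
apply: le_trans (ler_wpM2l (ltW k0) (hC n)) _.
rewrite mulrDr mulrA [_ * (d / _)]mulrC divfK ?gt_eqF //.
Qed.

Lemma quad_small_le f g : (forall n, `|f n| <= g n) -> quad_small g -> quad_small f.
Proof.
move=> fg hg d d0; have [C hC] := hg d d0; exists C => n.
by apply: le_trans (fg n) _; apply: le_trans (ler_norm _) (hC n).
Qed.

Lemma quad_small_linear (K : R) : quad_small (fun n => K * n%:R).
Proof.
move=> d d0; exists (`|K| ^+ 2 / d) => n; rewrite normrM normr_nat.
exact: linear_le_quad.
Qed.

(** Terms with [e <= M] are at most 1, the later ones at most [1 / M]. With [M] free this says that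
    the harmonic sum is [o(n)], without logarithms. *)
Lemma harmonic_le (M n : nat) : (0 < M)%N ->
  \sum_(1 <= e < n.+1) (e%:R)^-1 <= M%:R + n%:R / M%:R :> R.
Proof.
move=> M0; have Mr : 0 < M%:R :> R by rewrite ltr0n.
have le_n k : \sum_(1 <= e < k.+1) (e%:R)^-1 <= k%:R :> R.
  elim: k => [|k IH]; first by rewrite big_geq.
  rewrite big_nat_recr //= -[k.+1 in leRHS]addn1 natrD lerD //.
  by rewrite invf_le1 ?ltr0n // ler1n.
elim: n => [|n IH]; first by rewrite big_geq // mul0r addr0 ler0n.
have [nM|Mn] := leqP n.+1 M.
  apply: le_trans (le_n _) _; apply: (@le_trans _ _ M%:R); first by rewrite ler_nat.
  by rewrite lerDl divr_ge0.
rewrite big_nat_recr //= -[n.+1 in leRHS]addn1 natrD mulrDl addrA lerD //.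
by rewrite mul1r lef_pV2 ?posrE ?ltr0n // ler_nat ltnW.
Qed.

Lemma divn_sqr_bound (n e : nat) : (0 < e)%N ->
  0 <= (n%:R / e%:R : R) ^+ 2 - (n %/ e)%:R ^+ 2 <= 2 * n%:R * (e%:R)^-1.
Proof.
move=> e0; have er : 0 < e%:R :> R by rewrite ltr0n.
have l1 : (n %/ e)%:R <= n%:R / e%:R :> R.
  by rewrite ler_pdivlMr // -natrM ler_nat leq_divM.
have l2 : n%:R / e%:R <= (n %/ e)%:R + 1 :> R.
  by rewrite ler_pdivrMr // natr1 -natrM ler_nat ltnW // ltn_ceil.
have l0 : 0 <= (n %/ e)%:R :> R by rewrite ler0n.
rewrite -mulrA; move: l0 l1 l2; set x := n%:R / e%:R; set y := (n %/ e)%:R => l0 l1 l2.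
by rewrite !expr2; apply/andP; split; nra.
Qed.

Variable z : R.
Hypothesis zeta2_cvg : (fun N => \sum_(1 <= e < N) (e%:R ^+ 2)^-1 : R) @ \oo --> z.

Lemma zeta2_partial_le N : \sum_(1 <= e < N) (e%:R ^+ 2)^-1 <= z.
Proof.
rewrite -(cvg_lim _ zeta2_cvg) //; apply: nondecreasing_cvgn_le.
  apply/nondecreasing_seqP => -[|n]; first by rewrite !big_geq.
  by rewrite [leRHS]big_nat_recr //= lerDl invr_ge0 sqr_ge0.
by apply/cvg_ex; exists z.
Qed.

(** Without the floors the sum is [n ^ 2] times a partial sum of the series for [z]; the floors cost
    at most [2 * n] times the harmonic sum. *)
Lemma sum_divn_sqr : quad_small (fun n => \sum_(1 <= e < n.+1) (n %/ e)%:R ^+ 2 - z * n%:R ^+ 2).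
Proof.
have z0 : 0 <= z by have := zeta2_partial_le 1; rewrite big_geq.
have h1 : quad_small (fun n => \sum_(1 <= e < n.+1) (e%:R ^+ 2)^-1 * n%:R ^+ 2 - z * n%:R ^+ 2).
  move=> d d0.
  have /cvgrPdist_le /(_ d d0) [N _ hN] := zeta2_cvg.
  exists (z * N%:R ^+ 2) => n; rewrite -mulr_suml -mulrBl normrM distrC.
  rewrite [`|n%:R ^+ 2|]ger0_norm ?sqr_ge0 //.
  have [Nn|nN] := leqP N n.
    apply: (@le_trans _ _ (d * n%:R ^+ 2)); last by rewrite lerDl mulr_ge0 ?sqr_ge0.
    by rewrite ler_wpM2r ?sqr_ge0 //; apply: hN => /=; rewrite leqW.
  apply: (@le_trans _ _ (z * N%:R ^+ 2)); last by rewrite lerDr mulr_ge0 ?sqr_ge0 // ltW.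
  apply: ler_pM => //; rewrite ?sqr_ge0 //.
    rewrite ger0_norm ?subr_ge0 ?zeta2_partial_le // lerBlDr lerDl.
    by apply: sumr_ge0 => i _; rewrite invr_ge0 sqr_ge0.
  by rewrite lerXn2r ?nnegrE ?ler0n // ler_nat ltnW.
have h2 : quad_small (fun n => 2 * n%:R * \sum_(1 <= e < n.+1) (e%:R)^-1).
  move=> d d0.
  (* [M > 4 / d] makes [2 * n ^ 2 / M] at most half of [d * n ^ 2]; the linear term [2 * M * n] uses
     the other half. *)
  pose M := (Num.bound (4 / d)).+1.
  have hM : 4 / d < M%:R.
    have h4 : 0 <= 4 / d by rewrite divr_ge0 // ltW.
    by rewrite (lt_le_trans (archi_boundP h4)) // ler_nat.
  have M0 : (0 < M)%N by [].
  have Mr : 0 < M%:R :> R by rewrite ltr0n.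
  clearbody M; exists ((2 * M%:R) ^+ 2 / (d / 2)) => n.
  rewrite ger0_norm; last first.
    by rewrite !mulr_ge0 // sumr_ge0 // => i _; rewrite invr_ge0.
  have d2 : 0 < d / 2 by rewrite divr_gt0.
  have lin := linear_le_quad (d / 2) (2 * M%:R) n d2.
  have n0 : 0 <= 2 * n%:R :> R by rewrite mulr_ge0.
  have := ler_wpM2l n0 (harmonic_le M n M0).
  have : 2 * n%:R * (n%:R / M%:R) <= d / 2 * n%:R ^+ 2.
    rewrite [leLHS](_ : _ = 2 / M%:R * n%:R ^+ 2); last by rewrite expr2; ring.
    rewrite ler_wpM2r ?sqr_ge0 // ler_pdivrMr //.
    by move: hM; rewrite ltr_pdivrMr //; lra.
  move: lin; move: (_ ^+ 2 / (d / 2)) (\sum_(1 <= e < _) _) => Q H.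
  rewrite !mulrDr; move: (n%:R / M%:R) (n%:R ^+ 2) => u v; lra.
have -> : (fun n => \sum_(1 <= e < n.+1) (n %/ e)%:R ^+ 2 - z * n%:R ^+ 2) =
  (fun n => (\sum_(1 <= e < n.+1) (e%:R ^+ 2)^-1 * n%:R ^+ 2 - z * n%:R ^+ 2) +
   -1 * (\sum_(1 <= e < n.+1) ((n%:R / e%:R) ^+ 2 - (n %/ e)%:R ^+ 2))) :> (nat -> R).
  apply/funext => n; rewrite sumrB.
  rewrite [\sum_(1 <= e < n.+1) (n%:R / e%:R) ^+ 2](_ : _ = \sum_(1 <= e < n.+1) (e%:R ^+ 2)^-1 * n%:R ^+ 2); first by ring.
  by apply: eq_bigr => e _; rewrite exprMn exprVn mulrC.
apply: quad_smallD => //; apply: quad_smallM; apply: quad_small_le h2 => n.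
rewrite mulr_sumr; apply: le_trans (ler_norm_sum _ _ _) _.
rewrite big_nat [leRHS]big_nat; apply: ler_sum => e /andP[e0 _].
by have /andP[l u] := divn_sqr_bound n e e0; rewrite ger0_norm.
Qed.

(** The term 1/4 plus a telescoping bound 1/2 for [e >= 3]. *)
Lemma sum_inv_sqr_from2 n : \sum_(2 <= e < n.+1) (e%:R ^+ 2)^-1 <= 3 / 4 :> R.
Proof.
case: n => [|[|n]]; first by rewrite big_geq //; lra.
  by rewrite big_geq //; lra.
suff : \sum_(2 <= e < n.+3) (e%:R ^+ 2)^-1 <= 3 / 4 - (n.+2%:R)^-1 :> R.
  by move/le_trans; apply; rewrite lerBlDr lerDl invr_ge0.
elim: n => [|n IH]; first by rewrite big_nat1; lra.
rewrite big_nat_recr //=; apply: (le_trans (lerD IH (lexx _))).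
have h : 2 <= n.+2%:R :> R by rewrite ler_nat.
rewrite -[n.+3]addn1 natrD; move: (n.+2%:R : R) h => x x2.
suff : ((x + 1) ^+ 2)^-1 <= x^-1 - (x + 1)^-1 by lra.
have -> : x^-1 - (x + 1)^-1 = (x * (x + 1))^-1.
  by field; apply/andP; split; apply/negP => /eqP; lra.
by rewrite lef_pV2 ?posrE ?expr2; nra.
Qed.

Variables (G : nat -> R) (kappa K : R).
Hypothesis G_bound : forall n, `|G n| <= K * n%:R ^+ 2 + K.
Hypothesis G_sum :
  quad_small (fun n => \sum_(1 <= e < n.+1) G (n %/ e) - kappa * z * n%:R ^+ 2).

Let E n := G n - kappa * n%:R ^+ 2.

Let E_sum : quad_small (fun n => \sum_(1 <= e < n.+1) E (n %/ e)).
Proof.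
have -> : (fun n => \sum_(1 <= e < n.+1) E (n %/ e)) = (fun n =>
   (\sum_(1 <= e < n.+1) G (n %/ e) - kappa * z * n%:R ^+ 2) +
   - kappa * (\sum_(1 <= e < n.+1) (n %/ e)%:R ^+ 2 - z * n%:R ^+ 2)).
  by apply/funext => n; rewrite sumrB -mulr_sumr; ring.
by apply: quad_smallD => //; apply: quad_smallM; exact: sum_divn_sqr.
Qed.

(* Since [\sum_(e >= 2) 1 / e ^ 2 < 1], isolating the term [e = 1] of [E_sum]
   improves any quadratic bound on [E] by a constant factor. *)
Let E_improve (L : R) : 0 < L ->
  (exists C, forall n, `|E n| <= L * n%:R ^+ 2 + C) ->
  exists C, forall n, `|E n| <= 7 / 8 * L * n%:R ^+ 2 + C.
Proof.
move=> L0 [C hC].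
(* [3/4 + 1/16 + 1/16 = 7/8]: the two sixteenths pay for [E_sum] and for the linear term
   [|C| * n]. *)
have d0 : 0 < L / 16 by rewrite divr_gt0.
have [C1 hC1] := E_sum _ d0.
exists (`|C1| + `|C| ^+ 2 / (L / 16) + `|E 0|) => n.
have c2 : 0 <= `|C| ^+ 2 / (L / 16) by rewrite divr_ge0 ?sqr_ge0 // ltW.
case: n => [|n].
  by rewrite expr2 !mulr0 add0r lerDr addr_ge0.
have := hC1 n.+1; rewrite big_ltn // divn1 => h1.
have h2 : `|\sum_(2 <= e < n.+2) E (n.+1 %/ e)| <= 3 / 4 * L * n.+1%:R ^+ 2 + `|C| * n.+1%:R.
  apply: le_trans (ler_norm_sum _ _ _) _.
  apply: (@le_trans _ _ (\sum_(2 <= e < n.+2) ((e%:R ^+ 2)^-1 * (L * n.+1%:R ^+ 2) + `|C|))).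
    rewrite big_nat [leRHS]big_nat; apply: ler_sum => e /andP[e2 _].
    have e0 : (0 < e)%N by apply: leq_trans e2.
    apply: le_trans (hC _) _; apply: lerD; last exact: ler_norm.
    rewrite [leRHS]mulrCA; apply: ler_wpM2l; first exact: ltW.
    have /andP[+ _] := divn_sqr_bound n.+1 e e0.
    by rewrite subr_ge0 exprMn exprVn mulrC.
  rewrite big_split /= -mulr_suml; apply: lerD.
    rewrite -[leRHS]mulrA; apply: ler_wpM2r; last exact: sum_inv_sqr_from2.
    by rewrite mulr_ge0 ?sqr_ge0 // ltW.
  rewrite sumr_const_nat -[leLHS]mulr_natr; apply: ler_wpM2l => //.
  by rewrite ler_nat; lia.
have h3 := linear_le_quad (L / 16) `|C| n.+1 d0.
have h4 := ler_norm C1.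
have h5 := normr_ge0 (E 0).
have h6 : `|E n.+1| <= `|E n.+1 + \sum_(2 <= e < n.+2) E (n.+1 %/ e)| + `|\sum_(2 <= e < n.+2) E (n.+1 %/ e)|.
  by rewrite -[X in `|X| <= _](addrK (\sum_(2 <= e < n.+2) E (n.+1 %/ e))) ler_normB.
lra.
Qed.

Lemma divisor_sum_quadratic : quad_small (fun n => G n - kappa * n%:R ^+ 2).
Proof.
pose L0 : R := `|K| + `|kappa| + 1.
have L0_gt0 : 0 < L0 by rewrite ltr_wpDl // addr_ge0.
have iterate j : exists C : R, forall n, `|E n| <= (7 / 8) ^+ j * L0 * n%:R ^+ 2 + C.
  elim: j => [|j IH].
    exists `|K| => n; rewrite expr0 mul1r /L0.
    apply: le_trans (ler_normB _ _) _.
    rewrite normrM [`|n%:R ^+ 2|]ger0_norm ?sqr_ge0 //.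
    apply: le_trans (lerD (G_bound n) (lexx _)) _.
    have := ler_norm K; have := sqr_ge0 (n%:R : R); move: (n%:R ^+ 2) => x x0 KK.
    have := ler_wpM2r x0 KK; rewrite !mulrDl; lra.
  have -> : (7 / 8) ^+ j.+1 * L0 = 7 / 8 * ((7 / 8) ^+ j * L0) by rewrite exprS; ring.
  by apply: E_improve => //; rewrite mulr_gt0 // exprn_gt0 // divr_gt0.
move=> d d0.
have : (fun j => L0 * (7 / 8) ^+ j : R) @ \oo --> 0.
  by apply: cvg_geometric; rewrite ger0_norm; lra.
move=> /cvgrPdist_lt /(_ d d0) [j _ /(_ j (leqnn j))] /=.
rewrite sub0r normrN ger0_norm; last by rewrite mulr_ge0 ?exprn_ge0 ?ltW //; lra.
move=> hj; have [C hC] := iterate j; exists C => n.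
apply: le_trans (hC n) _; rewrite lerD // ler_wpM2r ?sqr_ge0 // mulrC ltW //.
Qed.

End QuadraticallySmall.

(** Both sides sum [f d] over the pairs with [d * e <= n]. *)
Lemma sum_divn_indicator (V : nmodType) (n : nat) (f : nat -> V) :
  \sum_(1 <= e < n.+1) \sum_(1 <= d < (n %/ e).+1) f d =
  \sum_(1 <= d < n.+1) f d *+ (n %/ d).
Proof.
transitivity (\sum_(1 <= e < n.+1) \sum_(1 <= d < n.+1) if (d * e <= n)%N then f d else 0).
  rewrite big_nat [RHS]big_nat; apply: eq_bigr => e /andP[e0 _].
  rewrite (big_nat_widen _ _ n.+1) ?ltnS ?leq_div // big_mkcond /=.
  by apply: eq_bigr => d _; rewrite ltnS leq_divRL.
rewrite exchange_big big_nat [RHS]big_nat; apply: eq_bigr => d /andP[d0 _] /=.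
transitivity (\sum_(1 <= e < (n %/ d).+1) f d).
  rewrite [RHS](big_nat_widen _ _ n.+1) ?ltnS ?leq_div // [RHS]big_mkcond /=.
  by apply: eq_bigr => e _; rewrite ltnS leq_divRL // mulnC.
by rewrite sumr_const_nat subSS subn0.
Qed.

(** * Growth of [d_n] *)

Section CyclotomicGrowth.
Variables (R : realType) (p : nat).
Hypothesis p_gt1 : (1 < p)%N.
Local Notation pr := (p%:R : R).

Definition ln_cyclotomic (k : nat) : R := ln (('Phi_k).[p%:Z]%:~R).

Definition ln_cyclotomic_prod (n : nat) : R := ln ((cyclotomic_prod n p%:Z)%:~R).

Lemma ln_prod (r : seq nat) (f : nat -> R) : (forall i, i \in r -> 0 < f i) ->
  ln (\prod_(i <- r) f i) = \sum_(i <- r) ln (f i).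
Proof.
elim: r => [|i r IH] f0; first by rewrite !big_nil ln1.
rewrite !big_cons lnM ?posrE ?f0 ?mem_head //; last first.
  by rewrite big_seq prodr_gt0 // => j jr; rewrite f0 // in_cons jr orbT.
by rewrite IH // => j jr; rewrite f0 // in_cons jr orbT.
Qed.

Lemma ln_cyclotomic_prodE n :
  ln_cyclotomic_prod n = \sum_(1 <= k < n.+1) ln_cyclotomic k.
Proof.
rewrite /ln_cyclotomic_prod /cyclotomic_prod rmorph_prod /= ln_prod // => k.
by rewrite mem_index_iota => /andP[k0 _]; rewrite ltr0z cyclotomic_gt0.
Qed.

Lemma sum_ln_cyclotomic_divisors n : (0 < n)%N ->
  \sum_(1 <= d < n.+1 | (d %| n)%N) ln_cyclotomic d = ln (pr ^+ n - 1).
Proof.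
move=> n0; rewrite -big_filter.
transitivity (\sum_(d <- divisors n) ln_cyclotomic d).
  apply: perm_big; apply: uniq_perm.
  - by rewrite filter_uniq // iota_uniq.
  - exact: divisors_uniq.
  move=> d; rewrite mem_filter mem_index_iota -dvdn_divisors //.
  case: (boolP (d %| n)%N) => //= dvd.
  by rewrite (dvdn_gt0 n0 dvd) ltnS (dvdn_leq n0 dvd).
rewrite -ln_prod => [|d]; last first.
  by rewrite -dvdn_divisors // => /(dvdn_gt0 n0) d0; rewrite ltr0z cyclotomic_gt0.
by rewrite -rmorph_prod /= -horner_prod prod_Cyclotomic // !hornerE intrB rmorphXn.
Qed.

(** From [n] to [n.+1] the multiplicity [n %/ d] grows by one exactly when [d] divides [n.+1], so
    the left side grows by [ln (p ^ n.+1 - 1)]. *)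
Lemma sum_ln_cyclotomic_prod n :
  \sum_(1 <= e < n.+1) ln_cyclotomic_prod (n %/ e) =
  \sum_(1 <= k < n.+1) ln (pr ^+ k - 1).
Proof.
under eq_bigr => e _ do rewrite ln_cyclotomic_prodE.
rewrite sum_divn_indicator; elim: n => [|n IH]; first by rewrite !big_geq.
rewrite [RHS]big_nat_recr //= -IH -sum_ln_cyclotomic_divisors //.
rewrite [X in _ = _ + X]big_mkcond /=.
have -> : \sum_(1 <= d < n.+1) ln_cyclotomic d *+ (n %/ d) =
    \sum_(1 <= d < n.+2) ln_cyclotomic d *+ (n %/ d).
  by rewrite [RHS]big_nat_recr //= divn_small // mulr0n addr0.
rewrite -big_split /= big_nat [RHS]big_nat; apply: eq_bigr => d /andP[d0 _].
by rewrite divnS // mulrnDr addrC; case: ifP; rewrite ?mulr1n ?mulr0n.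
Qed.

Lemma ln_cyclotomic_prod_ge0 n : 0 <= ln_cyclotomic_prod n.
Proof.
by apply: ln_ge0; rewrite ler1z -gtz0_ge1 cyclotomic_prod_gt0.
Qed.

Lemma ln_pr_gt0 : 0 < ln pr.
Proof. by rewrite ln_gt0 // ltr1n. Qed.

Lemma sum_id_nat n : \sum_(1 <= k < n.+1) k%:R = (n%:R ^+ 2 + n%:R) / 2 :> R.
Proof.
elim: n => [|n IH]; first by rewrite big_geq // expr2 mul0r addr0 mul0r.
by rewrite big_nat_recr //= IH -natr1; field.
Qed.

Lemma ln_exprB1_bounds k : (0 < k)%N ->
  ln pr * k%:R - ln 2 <= ln (pr ^+ k - 1) <= ln pr * k%:R.
Proof.
move=> k0.
have p2 : 2 <= pr ^+ k.
  rewrite -natrX ler_nat (leq_trans p_gt1) //.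
  by rewrite -[leqLHS]expn1 leq_exp2l.
have e : ln pr * k%:R = ln (pr ^+ k) by rewrite lnXn ?ltr0n 1?ltnW // mulr_natr.
have pk0 : 0 < pr ^+ k - 1 by lra.
rewrite e; apply/andP; split; last by rewrite ler_ln ?posrE //; lra.
rewrite -ln_div ?posrE //; last by lra.
by rewrite ler_ln ?posrE //; lra.
Qed.

Lemma sum_ln_exprB1 :
  quad_small R (fun n => \sum_(1 <= k < n.+1) ln (pr ^+ k - 1) - ln pr / 2 * n%:R ^+ 2).
Proof.
apply: (@quad_small_le _ _ (fun n => (ln 2 + ln pr) * n%:R)); last exact: quad_small_linear.
move=> n.
have ln2 : 0 < ln (2 : R) by rewrite ln_gt0 // ltr1n.
have lp := ln_pr_gt0.
have n0 : 0 <= n%:R :> R by [].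
have up : \sum_(1 <= k < n.+1) ln (pr ^+ k - 1) <= \sum_(1 <= k < n.+1) ln pr * k%:R.
  by rewrite big_nat [leRHS]big_nat; apply: ler_sum => k /andP[k0 _]; have /andP[] := ln_exprB1_bounds k k0.
have lo : \sum_(1 <= k < n.+1) (ln pr * k%:R - ln 2) <= \sum_(1 <= k < n.+1) ln (pr ^+ k - 1).
  by rewrite big_nat [leRHS]big_nat; apply: ler_sum => k /andP[k0 _]; have /andP[] := ln_exprB1_bounds k k0.
move: up lo; rewrite sumrB -mulr_sumr sum_id_nat sumr_const_nat subSS subn0 -[ln 2 *+ n]mulr_natr.
move: (\sum_(1 <= k < _) _) => S up lo.
have := mulr_ge0 (ltW lp) n0; have := mulr_ge0 (ltW ln2) n0.
by rewrite ler_norml; move=> ? ?; apply/andP; split; lra.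
Qed.

(** The summands of [sum_ln_cyclotomic_prod] are nonnegative, so the one with [e = 1] is at most the
    total. This a priori bound starts the contraction. *)
Lemma ln_cyclotomic_prod_le n : ln_cyclotomic_prod n <= ln pr * n%:R ^+ 2.
Proof.
case: n => [|n].
  by rewrite ln_cyclotomic_prodE big_geq // expr2 !mulr0.
have : ln_cyclotomic_prod n.+1 <= \sum_(1 <= e < n.+2) ln_cyclotomic_prod (n.+1 %/ e).
  by rewrite big_ltn // divn1 lerDl sumr_ge0 // => i _; exact: ln_cyclotomic_prod_ge0.
move=> /le_trans; apply; rewrite sum_ln_cyclotomic_prod.
have up : \sum_(1 <= k < n.+2) ln (pr ^+ k - 1) <= \sum_(1 <= k < n.+2) ln pr * k%:R.
  by rewrite big_nat [leRHS]big_nat; apply: ler_sum => k /andP[k0 _]; have /andP[] := ln_exprB1_bounds k k0.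
apply: le_trans up _; rewrite -mulr_sumr sum_id_nat.
apply: ler_wpM2l; first exact: (ltW ln_pr_gt0).
have : 1 <= n.+1%:R :> R by rewrite ler1n.
by rewrite expr2; move: (n.+1%:R : R) => x; nra.
Qed.

Lemma ln_cyclotomic_prod_quadratic (z : R) : z != 0 ->
  (fun N => \sum_(1 <= e < N) (e%:R ^+ 2)^-1 : R) @ \oo --> z ->
  quad_small R (fun n => ln_cyclotomic_prod n - ln pr / (2 * z) * n%:R ^+ 2).
Proof.
move=> z0 hz; apply: (divisor_sum_quadratic R z hz _ _ (ln pr)).
  move=> n; rewrite ger0_norm ?ln_cyclotomic_prod_ge0 //.
  by apply: le_trans (ln_cyclotomic_prod_le n) _; rewrite lerDl ltW // ln_pr_gt0.
rewrite (_ : (fun n => _) = (fun n => \sum_(1 <= k < n.+1) ln (pr ^+ k - 1) - ln pr / 2 * n%:R ^+ 2)).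
  exact: sum_ln_exprB1.
apply/funext => n; rewrite sum_ln_cyclotomic_prod; congr (_ - _ * _).
by field.
Qed.

End CyclotomicGrowth.

(** * Euler's sum and decimals of [pi ^ 2] *)

Section Basel.
Variable R : realType.
Local Notation pi := (@pi R).

(** By the mean value theorem [sin x = x * cos y] with [0 <= y <= x], and cosine decreases there. *)
Lemma sin_bounds (x : R) : 0 < x < pi / 2 -> x * cos x <= sin x <= x.
Proof.
move=> /andP[x0 xpi].
have pi0 := pi_gt0 R.
have [|y /itvP yI] := @MVT_segment _ sin cos 0 x (ltW x0).
  exact/continuous_subspaceT/continuous_sin.
rewrite sin0 !subr0 => ->.
apply/andP; split; last by rewrite ger_pMl // cos_le1.
rewrite mulrC ler_pM2r //.
have yx : y <= x by rewrite yI.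
have y0 : 0 <= y by rewrite yI.
move: yx; rewrite le_eqVlt => /predU1P[-> //|yx]; apply: ltW.
by rewrite ltr_cos // in_itv /=; apply/andP; split; lra.
Qed.

(** [1 / sin^2 x - 1] is the squared cotangent, and [x] lies between sine and tangent. *)
Lemma inv_sqr_bounds (x : R) : 0 < x < pi / 2 ->
  (sin x ^+ 2)^-1 - 1 <= (x ^+ 2)^-1 <= (sin x ^+ 2)^-1.
Proof.
move=> xI; have /andP[x0 _] := xI.
have s0 : 0 < sin x by exact: sin_gt0_pihalf.
have c0 : 0 < cos x.
  by apply: cos_gt0_pihalf; move: xI => /andP[? ?]; apply/andP; split; lra.
have /andP[l u] := sin_bounds x xI.
apply/andP; split; last by rewrite lef_pV2 ?posrE ?exprn_gt0 // lerXn2r // nnegrE ltW.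
have -> : (sin x ^+ 2)^-1 - 1 = (cos x / sin x) ^+ 2.
  rewrite expr_div_n cos2sin2 mulrBl mul1r divff // expf_neq0 // gt_eqF //.
rewrite -exprVn; apply: lerXn2r.
- by rewrite nnegrE divr_ge0 // ltW.
- by rewrite nnegrE invr_ge0 ltW.
by rewrite ler_pdivrMr // mulrC ler_pdivlMr // mulrC.
Qed.

Lemma csc2_double (x : R) : 0 < x < pi / 2 ->
  (sin x ^+ 2)^-1 + (sin (pi / 2 - x) ^+ 2)^-1 = 4 * (sin (2 * x) ^+ 2)^-1.
Proof.
move=> xI.
have s0 : sin x != 0 by rewrite gt_eqF //; exact: sin_gt0_pihalf.
have c0 : cos x != 0.
  by rewrite gt_eqF //; apply: cos_gt0_pihalf; move: xI => /andP[? ?]; apply/andP; split; lra.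
rewrite sinB cos_pihalf sin_pihalf mul0r subr0 mul1r [2 * x]mulr_natl sin_mulr2n.
have := cos2Dsin2 x; move: (cos x) (sin x) s0 c0 => c s s0 c0 e.
transitivity ((c ^+ 2 + s ^+ 2) / (s ^+ 2 * c ^+ 2)); first by field; rewrite s0 c0.
by rewrite e; field; rewrite s0 c0.
Qed.

Definition csc2_sum (N : nat) : R :=
  \sum_(1 <= k < N) (sin (k%:R * pi / (2 * N%:R)) ^+ 2)^-1.

Lemma angle_itv (N k : nat) : (0 < k < N)%N -> 0 < k%:R * pi / (2 * N%:R) < pi / 2.
Proof.
move=> /andP[k0 kN]; have N0 : 0 < N%:R :> R by rewrite ltr0n (ltn_trans k0).
have pi0 := pi_gt0 R.
have k0' : 0 < k%:R :> R by rewrite ltr0n.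
apply/andP; split; first by rewrite divr_gt0 // mulr_gt0.
rewrite ltr_pdivrMr; last by rewrite mulr_gt0.
have : k%:R < N%:R :> R by rewrite ltr_nat.
by move: (k%:R : R) (N%:R : R) N0 => a b b0 ab; nra.
Qed.

(** The angles of [k] and [2 * N - k] are complementary, so [csc2_double] merges the pair into the
    [k]-th term of the sum for [N]; the unpaired [k = N] gives [1 / sin^2 (pi / 4) = 2]. *)
Lemma csc2_sum_double N : (0 < N)%N -> csc2_sum (2 * N) = 4 * csc2_sum N + 2.
Proof.
move=> N0; rewrite /csc2_sum.
have Nr : (N%:R : R) != 0 by rewrite pnatr_eq0 -lt0n.
set g := fun k : nat => (sin (k%:R * pi / (2 * (2 * N)%:R)) ^+ 2)^-1.
transitivity (\sum_(1 <= k < 2 * N) g k) => //.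
have gE k : g k = (sin (k%:R * pi / (2 * (2 * N)%:R)) ^+ 2)^-1 by [].
clearbody g.
rewrite (big_cat_nat (n := N)) //=; last by lia.
rewrite (big_ltn (m := N)) /=; last by lia.
have -> : \sum_(N.+1 <= i < 2 * N) g i = \sum_(1 <= i < N) g (2 * N - i)%N.
  rewrite big_nat_rev -[N.+1]add1n big_addn.
  rewrite (_ : (2 * N - N = N)%N); last by lia.
  by rewrite big_nat [RHS]big_nat; apply: eq_bigr => i _; congr g; lia.
have -> : g N = 2.
  rewrite gE natrM (_ : N%:R * pi / (2 * (2 * N%:R)) = pi / 4); last by field.
  have pI : 0 < pi / 4 < pi / 2 by have := pi_gt0 R; lra.
  have := csc2_double _ pI.
  rewrite (_ : pi / 2 - pi / 4 = pi / 4); last by field.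
  rewrite (_ : 2 * (pi / 4) = pi / 2); last by field.
  by rewrite sin_pihalf expr1n invr1; lra.
rewrite addrCA addrC; congr (_ + _).
rewrite -big_split mulr_sumr big_nat [RHS]big_nat; apply: eq_bigr => k kN /=.
rewrite !gE; have h2N : (0 < k < 2 * N)%N by lia.
have := csc2_double _ (angle_itv _ _ h2N).
rewrite (_ : 2 * (k%:R * pi / (2 * (2 * N)%:R)) = k%:R * pi / (2 * N%:R)); last first.
  by rewrite natrM; field.
move=> <-; congr (_ + (sin _ ^+ 2)^-1).
by rewrite natrB ?natrM; [field | lia].
Qed.

Lemma csc2_sum_pow2 m : csc2_sum (2 ^ m) = 2 / 3 * ((2 ^ m)%:R ^+ 2 - 1).
Proof.
elim: m => [|m IH].
  by rewrite /csc2_sum expn0 big_geq // expr1n subrr mulr0.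
by rewrite expnS csc2_sum_double ?expn_gt0 // IH natrM; field.
Qed.

Local Notation zeta2_sum := (fun N => \sum_(1 <= e < N) (e%:R ^+ 2)^-1 : R).

(** [inv_sqr_bounds] at [k * pi / (2 * N)]; the error of at most 1 per term is negligible against
    [csc2_sum N], which is of order [N ^ 2] along powers of 2. *)
Lemma zeta2_sum_csc2 N : (0 < N)%N ->
  csc2_sum N - N%:R <= 4 * N%:R ^+ 2 / pi ^+ 2 * zeta2_sum N <= csc2_sum N.
Proof.
move=> N0; have Nr : (N%:R : R) != 0 by rewrite pnatr_eq0 -lt0n.
have pin0 : pi != 0 by rewrite gt_eqF // pi_gt0.
have e k : (0 < k)%N -> 4 * N%:R ^+ 2 / pi ^+ 2 * (k%:R ^+ 2)^-1 = ((k%:R * pi / (2 * N%:R)) ^+ 2)^-1 :> R.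
  move=> k0; have kr : (k%:R : R) != 0 by rewrite pnatr_eq0 -lt0n.
  move: kr {k0}; move: Nr pin0 {N0}; move: (pi) (N%:R : R) (k%:R : R) => a c d a0 c0 d0.
  by field; rewrite a0 c0 d0.
rewrite mulr_sumr; apply/andP; split.
  apply: (@le_trans _ _ (csc2_sum N - \sum_(1 <= k < N) 1)).
    by rewrite lerD2l lerN2 sumr_const_nat ler_nat leq_subr.
  rewrite -sumrB big_nat [leRHS]big_nat; apply: ler_sum => k /andP[k0 kN].
  have kI : (0 < k < N)%N by rewrite k0.
  by rewrite e //; have /andP[] := inv_sqr_bounds _ (angle_itv _ _ kI).
rewrite big_nat [leRHS]big_nat; apply: ler_sum => k /andP[k0 kN].
have kI : (0 < k < N)%N by rewrite k0.
by rewrite e //; have /andP[] := inv_sqr_bounds _ (angle_itv _ _ kI).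
Qed.

Lemma zeta2_sum_pow2 m :
  pi ^+ 2 / 6 - pi ^+ 2 / (2 ^ m)%:R <= zeta2_sum (2 ^ m)%N <= pi ^+ 2 / 6.
Proof.
have N0 : (0 < 2 ^ m)%N by rewrite expn_gt0.
have := zeta2_sum_csc2 _ N0; rewrite csc2_sum_pow2.
have N1 : 1 <= (2 ^ m)%:R :> R by rewrite ler1n.
move: ((2 ^ m)%:R : R) N1 (\sum_(1 <= e < _) _) => N N1 Z.
have pi0 : 0 < pi ^+ 2 by rewrite exprn_gt0 // pi_gt0.
move: (pi ^+ 2) pi0 => P P0.
have Nn0 : N != 0 by apply/negP => /eqP; lra.
have Pn0 : P != 0 by rewrite gt_eqF.
have c0 : 0 < P / (4 * N ^+ 2) by rewrite divr_gt0 // mulr_gt0 // exprn_gt0 //; lra.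
have eZ : P / (4 * N ^+ 2) * (4 * N ^+ 2 / P * Z) = Z by field; rewrite Nn0 Pn0.
move=> /andP[l u].
have := ler_wpM2l (ltW c0) l; have := ler_wpM2l (ltW c0) u.
rewrite eZ => {l u eZ} u l.
have V0 : 0 < N^-1 by rewrite invr_gt0; lra.
have V1 : N^-1 <= 1 by rewrite invf_le1 //; lra.
have eu : P / (4 * N ^+ 2) * (2 / 3 * (N ^+ 2 - 1)) = P / 6 - P / 6 * N^-1 ^+ 2 by field.
have el : P / (4 * N ^+ 2) * (2 / 3 * (N ^+ 2 - 1) - N) = P / 6 - P / 6 * N^-1 ^+ 2 - P / 4 * N^-1 by field.
move: u l; rewrite eu el; move: (N^-1) V0 V1 => V V0 V1 u l.
have PV0 : 0 <= P * V by rewrite mulr_ge0 ?ltW.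
have PV2 : 0 <= P * V ^+ 2 by rewrite mulr_ge0 ?sqr_ge0 ?ltW.
have PV3 : P * V ^+ 2 <= P * V by rewrite ler_wpM2l ?expr2 ?ler_piMl // ltW.
by apply/andP; split; lra.
Qed.

Lemma zeta2_sum_ndecr : nondecreasing_seq zeta2_sum.
Proof.
apply/nondecreasing_seqP => -[|n]; first by rewrite !big_geq.
by rewrite [leRHS]big_nat_recr //= lerDl invr_ge0 sqr_ge0.
Qed.

Lemma zeta2_sum_le N : zeta2_sum N <= pi ^+ 2 / 6.
Proof.
have /andP[_ u] := zeta2_sum_pow2 N; apply: le_trans u.
by apply: zeta2_sum_ndecr; rewrite ltnW // ltn_expl.
Qed.

Lemma zeta2_cvg : zeta2_sum @ \oo --> pi ^+ 2 / 6.
Proof.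
apply/cvgrPdist_le => e e0.
have P0 : 0 < pi ^+ 2 by rewrite exprn_gt0 // pi_gt0.
pose m := Num.bound (pi ^+ 2 / e).
have hm : pi ^+ 2 / e < m%:R by apply: archi_boundP; rewrite divr_ge0 // ltW.
exists (2 ^ m)%N => // N /= mN.
have lo : zeta2_sum (2 ^ m)%N <= zeta2_sum N by apply: zeta2_sum_ndecr.
have /andP[l _] := zeta2_sum_pow2 m.
rewrite ger0_norm ?subr_ge0 ?zeta2_sum_le //.
suff : pi ^+ 2 / (2 ^ m)%:R <= e by lra.
have m2 : m%:R <= (2 ^ m)%:R :> R by rewrite ler_nat ltnW // ltn_expl.
have m0 : 0 < (2 ^ m)%:R :> R by rewrite ltr0n expn_gt0.
rewrite ler_pdivrMr // mulrC -ler_pdivrMr //.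
exact: le_trans (ltW hm) m2.
Qed.

(** The comparison [1 / (m - 1/2 + e) - 1 / (m + 1/2 + e) <= 1 / m ^ 2] means
    [1/4 <= 2 * e * m + e ^ 2], which persists from [N] to all [m >= N]. With [e = 0] the inequality
    is reversed; a small shift turns that sharp upper estimate into a lower one. *)
Lemma zeta2_tail (e : R) (N n : nat) : 0 <= e -> 1 / 4 <= 2 * e * N%:R + e ^+ 2 -> (0 < N <= n)%N ->
  zeta2_sum N + (N%:R - 1 / 2 + e)^-1 - (n%:R - 1 / 2 + e)^-1 <= zeta2_sum n.
Proof.
move=> e0 eN /andP[N0 Nn]; rewrite -(subnKC Nn); elim: (n - N)%N => [|k IH].
  by rewrite addn0 addrK.
rewrite addnS big_nat_recr /=; last by lia.
set m := (N + k)%N in IH *.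
have Nm : N%:R <= m%:R :> R by rewrite ler_nat /m; lia.
have N1 : 1 <= N%:R :> R by rewrite ler1n.
have : (m%:R - 1 / 2 + e)^-1 - (m.+1%:R - 1 / 2 + e)^-1 <= (m%:R ^+ 2)^-1.
  rewrite -[m.+1%:R]natr1; move: (m%:R : R) (N%:R : R) Nm N1 eN => x y xy y1 hy.
  have -> : (x - 1 / 2 + e)^-1 - (x + 1 - 1 / 2 + e)^-1 = ((x - 1 / 2 + e) * (x + 1 / 2 + e))^-1.
    by field; apply/andP; split; apply/negP => /eqP; lra.
  have x20 : 0 < x ^+ 2 by rewrite exprn_gt0 //; lra.
  rewrite lef_pV2 ?posrE //; last by rewrite mulr_gt0 //; lra.
  have : 0 <= e * (x - y) by rewrite mulr_ge0 // subr_ge0.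
  move: hy; rewrite !expr2; lra.
by move: IH; lra.
Qed.

Lemma zeta2_tail_ub (N n : nat) : (0 < N <= n)%N ->
  zeta2_sum n <= zeta2_sum N + (N%:R - 1 / 2)^-1 - (n%:R - 1 / 2)^-1.
Proof.
move=> /andP[N0 Nn]; rewrite -(subnKC Nn); elim: (n - N)%N => [|k IH].
  by rewrite addn0 addrK.
rewrite addnS big_nat_recr /=; last by lia.
set m := (N + k)%N in IH *.
have m1 : 1 <= m%:R :> R by rewrite ler1n /m; lia.
have : (m%:R ^+ 2)^-1 <= (m%:R - 1 / 2)^-1 - (m.+1%:R - 1 / 2)^-1 :> R.
  rewrite -[m.+1%:R]natr1; move: (m%:R : R) m1 => x x1.
  have -> : (x - 1 / 2)^-1 - (x + 1 - 1 / 2)^-1 = ((x - 1 / 2) * (x + 1 / 2))^-1.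
    by field; apply/andP; split; apply/negP => /eqP; lra.
  have x20 : 0 < x ^+ 2 by rewrite exprn_gt0 //; lra.
  have q0 : 0 < (x - 1 / 2) * (x + 1 / 2) by rewrite mulr_gt0 //; lra.
  by rewrite lef_pV2 ?posrE // expr2; lra.
by move: IH; lra.
Qed.

(** The two rationals lie just inside the values of [y] at which [2 + 4 / (y - 2)] equals 2.50829
    and 2.50828. *)
Lemma pi_sqr_bounds : 9 + 869 / 10 ^+ 3 + 524 / 10 ^+ 6 < pi ^+ 2 < 9 + 869 / 10 ^+ 3 + 678 / 10 ^+ 6.
Proof.
have z25 : 1 + 604 / 10 ^+ 3 + 122 / 10 ^+ 6 < zeta2_sum 25%N < 1 + 604 / 10 ^+ 3 + 125 / 10 ^+ 6.
  by rewrite /index_iota /= !big_cons big_nil; lra.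
move: z25 => /andP[l25 u25].
apply/andP; split.
  (* Large enough for the end of the telescoping sum to cost at most [10 ^ -6]. *)
  pose n := Num.bound (2 * 10 ^+ 6 : R).
  have hn : 2 * 10 ^+ 6 < n%:R :> R by apply: archi_boundP; rewrite mulr_ge0 // exprn_ge0.
  clearbody n; have n25 : (0 < 25 <= n)%N by rewrite /= -(ler_nat R); lra.
  (* [e = 1/200] is the solution of [2 * e * 25 = 1/4]. *)
  have h : 1 / 4 <= 2 * (1 / 200) * 25%:R + (1 / 200) ^+ 2 :> R by lra.
  have e0 : 0 <= 1 / 200 :> R by lra.
  have := zeta2_tail _ _ _ e0 h n25; have := zeta2_sum_le n.
  have : (n%:R - 1 / 2 + 1 / 200)^-1 <= (10 ^+ 6)^-1 :> R.
    by rewrite lef_pV2 ?posrE ?exprn_gt0 //; lra.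
  have -> : (25%:R - 1 / 2 + 1 / 200)^-1 = 200 / 4901 :> R by field.
  move: (\sum_(1 <= e < 25) _) l25 {u25} (\sum_(1 <= e < n) _) => z l25 w.
  by move: ((n%:R - 1 / 2 + 1 / 200)^-1) (pi ^+ 2) => u v; lra.
have : pi ^+ 2 / 6 <= zeta2_sum 25%N + (25%:R - 1 / 2)^-1.
  rewrite -(cvg_lim _ zeta2_cvg) //; apply: limr_le; first by apply/cvg_ex; eexists; exact: zeta2_cvg.
  exists 25%N => // n /= n25.
  have n25' : (0 < 25 <= n)%N by [].
  have := zeta2_tail_ub _ _ n25'.
  have n1 : 1 <= n%:R :> R by rewrite ler1n; apply: leq_trans n25.
  have : 0 <= (n%:R - 1 / 2)^-1 :> R by rewrite invr_ge0; lra.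
  by lra.
have -> : (25%:R - 1 / 2)^-1 = 2 / 49 :> R by field.
by move: (\sum_(1 <= e < 25) _) u25 (pi ^+ 2) => z u v; lra.
Qed.

End Basel.

(** The index 0, which the estimates do not cover, goes into the constant. *)
Lemma quad_small_pos (R : realType) (f g : nat -> R) :
  (forall n, (0 < n)%N -> `|f n| <= `|g n|) -> quad_small R g -> quad_small R f.
Proof.
move=> fg hg d d0; have [C hC] := hg d d0.
exists (`|C| + `|f 0|) => -[|n].
  by rewrite expr2 !mulr0 add0r lerDr.
apply: le_trans (fg n.+1 isT) _; apply: le_trans (hC _) _.
by rewrite lerD2l (le_trans (ler_norm C)) // lerDl.
Qed.

(** * From linear forms with quadratic exponents to irrationality and its measure *)

Section IrrationalityMeasure.
Variables (R : realType) (x : R) (a b : nat -> R) (A B : R).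
Hypotheses (A_gt0 : 0 < A) (B_gt0 : 0 < B).
Hypothesis a_int : forall n, (0 < n)%N -> a n \is a Num.int.
Hypothesis b_int : forall n, (0 < n)%N -> b n \is a Num.int.
Hypothesis b_neq0 : forall n, (0 < n)%N -> b n != 0.
Hypothesis l_neq0 : forall n, (0 < n)%N -> b n * x - a n != 0.
Hypothesis ln_l : quad_small R (fun n => ln `|b n * x - a n| + A * n%:R ^+ 2).
Hypothesis ln_b : quad_small R (fun n => ln `|b n| - B * n%:R ^+ 2).

Lemma approximation_small (e : R) : 0 < e -> exists2 n, (0 < n)%N & `|b n * x - a n| < e.
Proof.
move=> e0.
have [C hC] := ln_l _ (divr_gt0 A_gt0 (ltr0Sn R 1)).
pose m := Num.bound ((`|C| + `|ln e|) * 2 / A).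
have hm : (`|C| + `|ln e|) * 2 / A < m%:R.
  by apply: archi_boundP; rewrite divr_ge0 ?mulr_ge0 ?addr_ge0 // ltW.
exists m.+1 => //; have l0 : 0 < `|b m.+1 * x - a m.+1| by rewrite normr_gt0 l_neq0.
rewrite -ltr_ln ?posrE //.
have := hC m.+1; rewrite ler_norml => /andP[_].
move: hm; rewrite ltr_pdivrMr // -[m.+1%:R]natr1 => hm.
have m0 : 0 <= m%:R :> R by [].
have := ler_norm C; have := ler_norm (- ln e); rewrite normrN.
have : A * m%:R <= A * (m%:R + 1) ^+ 2.
  by rewrite ler_pM2l // expr2; nra.
lra.
Qed.

(** Write [l = b n * x - a n]. The integer [z = u * b n - v * a n] satisfies
    [v * b n * (x - u / v) = v * l - z]. If [z = 0] there is equality; otherwise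
    [|v * l - z| >= 1 - 1/2 > v * |l|]. *)
Lemma approximation_gap (u v : int) n : (0 < n)%N -> 1 <= v ->
  2 * v%:~R * `|b n * x - a n| < 1 ->
  `|b n * x - a n| / `|b n| <= `|x - u%:~R / v%:~R|.
Proof.
move=> n0 v1 hl.
have v0 : 0 < (v%:~R : R) by rewrite ltr0z; apply: lt_le_trans v1.
have bn0 : 0 < `|b n| by rewrite normr_gt0 b_neq0.
rewrite ler_pdivrMr // -(ler_pM2l v0).
set z := u%:~R * b n - v%:~R * a n.
have zint : z \is a Num.int by rewrite rpredB ?rpredM ?rpred_int ?a_int ?b_int.
have -> : v%:~R * (`|x - u%:~R / v%:~R| * `|b n|) = `|v%:~R * (b n * x - a n) - z|.
  rewrite -{1}(gtr0_norm v0) -!normrM; congr `|_|.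
  by rewrite /z; field; rewrite gt_eqF.
have [->|zn0] := eqVneq z 0; first by rewrite subr0 normrM gtr0_norm.
have z1 : 1 <= `|z| by exact: norm_intr_ge1.
have := ler_distD (v%:~R * (b n * x - a n)) z 0; rewrite !subr0 distrC normrM [`|v%:~R|]gtr0_norm //.
lra.
Qed.

Lemma approximation_irrational : irrational x.
Proof.
move=> /rationalP[u [v xE]].
(* [v = 0] is a genuine case: division by zero then makes [x = 0], and some [a n] would be a nonzero
   integer of absolute value below 1. *)
have [v0|v0] := posnP v.
  have [n n0] := approximation_small 1 ltr01.
  rewrite xE v0 invr0 mulr0 mulr0 sub0r normrN => an1.
  have := l_neq0 n n0; rewrite xE v0 invr0 mulr0 mulr0 sub0r oppr_eq0 => an0.
  by have := norm_intr_ge1 (a_int n n0) an0; rewrite leNgt an1.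
have vr : 0 < v%:R :> R by rewrite ltr0n.
have e1 : 0 < (v%:R)^-1 :> R by rewrite invr_gt0.
have [n n0 hn] := approximation_small _ e1.
have zint : v%:R * (b n * x - a n) \is a Num.int.
  rewrite (_ : _ * _ = b n * u%:~R - v%:R * a n).
    by rewrite rpredB ?rpredM ?rpred_int ?rpred_nat ?a_int ?b_int.
  by rewrite xE; field; rewrite gt_eqF.
have z0 : v%:R * (b n * x - a n) != 0 by rewrite mulf_neq0 ?l_neq0 // gt_eqF.
have := norm_intr_ge1 zint z0; rewrite normrM gtr0_norm // leNgt.
by rewrite mulrC -ltr_pdivlMr // mul1r hn.
Qed.

(** Let [r > 1 + B / A] and let [u / v] be closer to [x] than [1 / v ^ r]. For the least [n] with
    [2 * v * |b n * x - a n| < 1], the gap lemma bounds [r * ln v] above by about [(A + B) * n ^ 2],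
    while failure at [n - 1] bounds it below by about [r * A * (n - 1) ^ 2]. As [r * A > A + B], [n]
    is bounded, hence [v], hence [u]. *)
Lemma irrationality_measure_le : (irrationality_measure x <= (1 + B / A)%:E)%E.
Proof.
apply/lee_addgt0Pr => e e0; set r := 1 + B / A + e.
have cBA : 0 < B / A by rewrite divr_gt0.
have r0 : 0 < r by rewrite /r; lra.
apply: ereal_inf_lbound; exists r => //=.
have gap0 : 0 < r * A - A - B.
  have eq : r * A - A - B = e * A by rewrite /r; field; rewrite gt_eqF.
  by rewrite eq mulr_gt0.
clearbody r.
(* The error [d] enters [al - be] with total weight [r + 2], so this choice preserves half of the
   gap [r * A - A - B]. *)
pose d := (r * A - A - B) / (2 * (r + 2)).
have d0 : 0 < d by rewrite divr_gt0 // mulr_gt0 //; lra.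
have [C1 hC1] := ln_l _ d0.
have [C2 hC2] := ln_b _ d0.
pose al := r * (A - d); pose be := A + B + 2 * d.
have gap : al - be = (r * A - A - B) / 2.
  rewrite /al /be /d; field; apply/negP => /eqP; lra.
clearbody d.
have [alE beE] : al = r * (A - d) /\ be = A + B + 2 * d by [].
clearbody al be.
have be0 : 0 < be by rewrite beE !addr_gt0 // mulr_gt0.
have albe : 0 < (al - be) / 2 by rewrite gap !divr_gt0.
have ln2 : 0 < ln (2 : R) by rewrite ln_gt0 // ltr1n.
pose K : R := `|C1| + `|C2| + r * (`|C1| + ln 2).
have K0 : 0 <= K by rewrite !addr_ge0 // mulr_ge0 ?addr_ge0 // ltW.
pose M := ((2 * al) ^+ 2 / ((al - be) / 2) + K) / ((al - be) / 2).
pose Y := (be * M + `|C1| + `|C2|) / r.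
have bound_v (u v : int) : 1 <= v -> `|x - u%:~R / v%:~R| < 1 / (v%:~R `^ r) -> (v%:~R : R) <= expR Y.
  move=> v1 huv.
  have v0 : 0 < (v%:~R : R) by rewrite ltr0z; apply: lt_le_trans v1.
  have v1' : 1 <= (v%:~R : R) by rewrite ler1z.
  have ex : exists n, (0 < n)%N && (2 * v%:~R * `|b n * x - a n| < 1).
    have e1 : 0 < (2 * v%:~R)^-1 :> R by rewrite invr_gt0 mulr_gt0.
    have [n n0 hn] := approximation_small _ e1.
    by exists n; rewrite n0 /= mulrC -ltr_pdivlMr ?mulr_gt0 // mul1r.
  case: (ex_minnP ex) => n /andP[n0 hn] nmin.
  have ln0 m : (0 < m)%N -> 0 < `|b m * x - a m| by move=> m0; rewrite normr_gt0 l_neq0.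
  have bn0 : 0 < `|b n| by rewrite normr_gt0 b_neq0.
  have h1 : r * ln v%:~R <= be * n%:R ^+ 2 + `|C1| + `|C2|.
    have := le_lt_trans (approximation_gap u v n n0 v1 hn) huv.
    have pw : 0 < v%:~R `^ r by rewrite powR_gt0.
    rewrite -ltr_ln ?posrE ?divr_gt0 ?ln0 // !ln_div ?posrE ?ln0 // ln1 ln_powR.
    have := hC1 n; rewrite ler_norml => /andP[+ _].
    have := hC2 n; rewrite ler_norml => /andP[_ +].
    by have := ler_norm C1; have := ler_norm C2; rewrite beE; lra.
  have h2 : al * (n%:R - 1) ^+ 2 <= r * ln v%:~R + r * (`|C1| + ln 2).
    rewrite alE -mulrA -mulrDr ler_pM2l //.
    case: n n0 hn nmin h1 bn0 => // -[|n] _ hn nmin h1 bn0.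
      (* For [n = 1] there is no earlier positive index to exploit, but the left side is then
         zero. *)
      by rewrite subrr expr2 !mulr0; have := ln_ge0 v1'; have := normr_ge0 C1; lra.
    have : ~~ ((0 < n.+1)%N && (2 * v%:~R * `|b n.+1 * x - a n.+1| < 1)).
      by apply/negP => /nmin; rewrite ltnn.
    rewrite /= -leNgt -ler_ln ?posrE ?mulr_gt0 ?ln0 // ln1 !lnM ?posrE ?mulr_gt0 ?ln0 //.
    have -> : n.+2%:R - 1 = n.+1%:R :> R by rewrite -[n.+2%:R]natr1 addrK.
    have := hC1 n.+1; rewrite ler_norml => /andP[_ +].
    by have := ler_norm C1; rewrite mulrBl; lra.
  have h3 : n%:R ^+ 2 <= M.
    rewrite /M ler_pdivlMr //.
    have := linear_le_quad R ((al - be) / 2) (2 * al) n albe.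
    have al0 : 0 < al by lra.
    move: (_ ^+ 2 / ((al - be) / 2)) => Q; rewrite /K.
    move: h1 h2; move: (r * ln v%:~R) (r * (`|C1| + ln 2)) (n%:R : R) => w t y.
    by rewrite !expr2; lra.
  have h4 : ln v%:~R <= Y.
    rewrite /Y ler_pdivlMr // mulrC; apply: le_trans h1 _.
    by have := ler_wpM2l (ltW be0) h3; lra.
  by rewrite -[leLHS]lnK ?posrE // ler_expR.
pose m := Num.bound ((`|x| + 1) * expR Y).
have hm : (`|x| + 1) * expR Y < m%:R.
  by apply: archi_boundP; rewrite mulr_ge0 ?addr_ge0 // ltW // expR_gt0.
apply: (@sub_finite_set _ _ ([set u : int | `|u| <= m%:Z] `*` [set u : int | `|u| <= m%:Z])).
  move=> [u v] /= [v1 huv].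
  have v0 : 0 < (v%:~R : R) by rewrite ltr0z; apply: lt_le_trans v1.
  have v1' : 1 <= (v%:~R : R) by rewrite ler1z.
  have vY := bound_v u v v1 huv.
  have pw : 1 <= v%:~R `^ r by have := ler_powR v1' (ltW r0); rewrite powRr0.
  have hx : `|u%:~R| <= (`|x| + 1) * v%:~R :> R.
    have : `|x - u%:~R / v%:~R| <= 1.
      by apply: le_trans (ltW huv) _; rewrite ler_pdivrMr ?mul1r // (lt_le_trans _ pw).
    have := ler_distD x (u%:~R / v%:~R) 0; rewrite !subr0 [`|_ - x|]distrC normrM normfV.
    rewrite [`|v%:~R|]gtr0_norm // => h1 h2.
    by rewrite -ler_pdivrMr //; lra.
  have x0 := normr_ge0 x; have eY := expR_gt0 Y.
  have bnd (w : int) : `|w%:~R| <= (`|x| + 1) * expR Y :> R -> `|w| <= m%:Z.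
    by move=> hw; rewrite -(ler_int R) intr_norm ltW // (le_lt_trans hw).
  split; apply: bnd.
    by apply: le_trans hx _; rewrite ler_wpM2l // addr_ge0.
  rewrite gtr0_norm //; apply: le_trans vY _; rewrite -[leLHS]mul1r.
  by apply: ler_wpM2r; [exact: ltW | rewrite lerDr].
have fin : finite_set [set u : int | `|u| <= m%:Z].
  apply: (@sub_finite_set _ _ ((fun i : nat => i%:Z - m%:Z) @` `I_(2 * m).+1)).
    move=> u /=; rewrite ler_norml => /andP[h1 h2].
    by exists (absz (u + m%:Z)%R); lia.
  exact/finite_image/finite_II.
exact: finite_setX.
Qed.

End IrrationalityMeasure.

Lemma quad_small_root_cvg (R : realType) (u : nat -> R) (A : R) :
  (forall n, (0 < n)%N -> u n != 0) ->
  quad_small R (fun n => ln `|u n| + A * n%:R ^+ 2) ->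
  (fun n : nat => `|u n| `^ (1 / n%:R ^+ 2)) @ \oo --> expR (- A).
Proof.
move=> u0 hu.
apply: (@cvg_trans _ ((fun n : nat => expR (ln `|u n| / n%:R ^+ 2)) @ \oo)).
  apply: near_eq_cvg; near=> n.
  have n0 : (0 < n)%N by near: n; exists 1%N.
  by rewrite /powR normr_eq0 (negbTE (u0 n n0)) mul1r mulrC.
apply: continuous_cvg; first exact: continuous_expR.
apply/cvgrPdist_le => e e0.
have e2 : 0 < e / 2 by rewrite divr_gt0.
have [C hC] := hu _ e2.
pose m := Num.bound (`|C| / (e / 2)).
have hm : `|C| / (e / 2) < m%:R by apply: archi_boundP; rewrite divr_ge0 // ltW.
exists m.+1 => // n /= mn.
have n1 : 1 <= n%:R :> R by rewrite ler1n (leq_trans _ mn).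
have nm : m%:R <= n%:R :> R by rewrite ler_nat ltnW.
have n2 : 0 < n%:R ^+ 2 :> R by rewrite exprn_gt0 //; lra.
rewrite -normrN opprB opprK.
rewrite -(ler_pM2r n2) -[X in _ * X <= _](gtr0_norm n2) -normrM mulrDl divfK ?gt_eqF //.
apply: le_trans (hC n) _.
have h : `|C| <= e / 2 * n%:R ^+ 2.
  apply: (@le_trans _ _ (e / 2 * n%:R)).
    by rewrite mulrC -ler_pdivrMr //; apply: le_trans nm; exact: ltW.
  by rewrite ler_pM2l // expr2; nra.
by have := ler_norm C; lra.
Unshelve. all: by end_near.
Qed.

(** * Exponents of [b_n] and of [b_n h - a_n] *)

Section Asymptotics.
Variables (R : realType) (p : nat).
Hypothesis p_gt1 : (1 < p)%N.
Local Notation pr := (p%:R : R).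
Local Notation P := (@little_qLegendre R (pr^-1)).

(** The exponent of [p] in the dominant term of [P_n(p ^ n)]; the constant [3/2] comes from here. *)
Lemma sqr_bin2 n : (n * n + 'C(n, 2))%:R = 3 / 2 * n%:R ^+ 2 - n%:R / 2 :> R.
Proof.
have : ('C(n, 2))%:R * 2 = n%:R * (n%:R - 1) :> R.
  elim: n => [|n IH]; first by rewrite !mul0r.
  by rewrite binS bin1 natrD -natr1 mulrDl IH; ring.
by rewrite natrD natrM expr2; lra.
Qed.

Lemma ln_legendre_pn n : (0 < n)%N ->
  `|ln `|(P n).[pr ^+ n]| - 3 / 2 * ln pr * n%:R ^+ 2| <= (ln 2 + ln pr) * n%:R.
Proof.
move=> n0.
have lp := ln_pr_gt0 R p p_gt1.
have p0 : 0 < pr by rewrite ltr0n ltnW.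
have l2 : 0 < ln (2 : R) by rewrite ln_gt0 // ltr1n.
have n1 : 1 <= n%:R :> R by rewrite ler1n.
have P0 := legendre_pn_gt0 R p p_gt1 n n0.
have nE : `|(P n).[pr ^+ n]| = (-1) ^+ n * (P n).[pr ^+ n].
  by rewrite -(gtr0_norm P0) normrM normrX normrN1 expr1n mul1r.
have := legendre_pn_bounds R p p_gt1 n n0; rewrite -horner_little_qLegendre // -nE.
have := legendre_termnn_bounds R p p_gt1 n.
move: (legendre_term _ _ _ _) (`|_|) => t w /andP[t1 t2] /andP[w1 w2].
have pX : 0 < pr ^+ (n * n + 'C(n, 2)) by rewrite exprn_gt0.
have t0 : 0 < t by apply: lt_le_trans t1.
have w0 : 0 < w by apply: lt_le_trans w1; rewrite divr_gt0.
have : ln t <= ln 2 * n%:R + ln pr * (n * n + 'C(n, 2))%:R.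
  rewrite !mulr_natr -!lnXn // -lnM ?posrE ?exprn_gt0 // ler_ln ?posrE //.
  by rewrite mulr_gt0 // exprn_gt0.
have : ln pr * (n * n + 'C(n, 2))%:R <= ln t.
  by rewrite mulr_natr -lnXn // ler_ln ?posrE.
have : ln w <= ln t by rewrite ler_ln ?posrE.
have : ln t - ln 2 <= ln w by rewrite -ln_div ?posrE // ler_ln ?posrE // divr_gt0.
rewrite sqr_bin2.
have := mulr_ge0 (ltW lp) (ler0n R n).
have : ln 2 <= ln 2 * n%:R :> R by rewrite ler_peMr // ltW.
move: (ln w) (ln t) => a b h1 h2 h3 h4 h5 h6.
by rewrite ler_norml; apply/andP; split; lra.
Qed.

Lemma ln_legendre_remainder n : (0 < n)%N ->
  `|ln `|legendre_remainder R p n| + 3 / 2 * ln pr * n%:R ^+ 2|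
    <= (ln 2 + ln pr + (ln 2 + ln 4 + ln 9 + 5 * ln pr)) * n%:R.
Proof.
move=> n0.
have lp := ln_pr_gt0 R p p_gt1.
have p0 : 0 < pr by rewrite ltr0n ltnW.
have l2 : 0 < ln (2 : R) by rewrite ln_gt0 // ltr1n.
have l4 : 0 < ln (4 : R) by rewrite ln_gt0 // ltr1n.
have l9 : 0 < ln (9 : R) by rewrite ln_gt0 // ltr1n.
have n1 : 1 <= n%:R :> R by rewrite ler1n.
have /andP[s1 s2] := legendre_remainder_bounds R p p_gt1 n n0.
have := ln_legendre_pn n n0.
set w := (P n).[pr ^+ n] in s1 s2 *; set r := legendre_remainder R p n in s1 s2 *.
have low0 : 0 < 1 / 4 * pr ^- (n + (3 * n).+1) by rewrite mulr_gt0 ?divr_gt0 ?prV_gt0.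
have wr0 : 0 < w * r by apply: lt_le_trans s1.
have w0 : w != 0 by apply: contraTneq wr0 => ->; rewrite mul0r ltxx.
have r0 : r != 0 by apply: contraTneq wr0 => ->; rewrite mulr0 ltxx.
have e : ln (w * r) = ln `|w| + ln `|r|.
  by rewrite -lnM ?posrE ?normr_gt0 // -normrM gtr0_norm.
have : ln (w * r) <= ln 2 + ln 9 * n%:R.
  have b0 : 0 < 2 * 9 ^+ n :> R by rewrite mulr_gt0 // exprn_gt0.
  by rewrite mulr_natr -lnXn // -lnM ?posrE ?exprn_gt0 // ler_ln ?posrE.
have : - ln 4 - ln pr * (n + (3 * n).+1)%:R <= ln (w * r).
  rewrite mulr_natr -lnXn // -opprD -lnM ?posrE ?exprn_gt0 // -lnV ?posrE ?mulr_gt0 ?exprn_gt0 //.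
  by rewrite invfM -[4^-1]mul1r ler_ln ?posrE.
have -> : (n + (3 * n).+1 = 4 * n + 1)%N by lia.
rewrite e [(4 * n + 1)%:R]natrD [(4 * n)%:R]natrM.
have := mulr_ge0 (ltW lp) (ler0n R n).
have : ln 2 <= ln 2 * n%:R :> R by rewrite ler_peMr // ltW.
have : ln 4 <= ln 4 * n%:R :> R by rewrite ler_peMr // ltW.
have : ln pr <= ln pr * n%:R :> R by rewrite ler_peMr // ltW.
have : 0 <= ln 9 * n%:R :> R by rewrite mulr_ge0 // ltW.
move: (ln `|w|) (ln `|r|) => a b h1 h2 h3 h4 h5 h6 h7.
by rewrite !ler_norml => /andP[h8 h9]; apply/andP; split; lra.
Qed.

Lemma ln_cyclotomic_prod_asymptotic :
  quad_small R (fun n => ln_cyclotomic_prod R p n - 3 * ln pr / pi ^+ 2 * n%:R ^+ 2).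
Proof.
have pi0 : (pi : R) != 0 by rewrite gt_eqF // pi_gt0.
have z0 : (pi : R) ^+ 2 / 6 != 0 by rewrite mulf_neq0 // expf_neq0.
have := ln_cyclotomic_prod_quadratic R p p_gt1 _ z0 (zeta2_cvg R).
rewrite (_ : ln pr / (2 * (pi ^+ 2 / 6)) = 3 * ln pr / pi ^+ 2) //.
by move: (pi : R) pi0 {z0} => y y0; field.
Qed.

Lemma cyclotomic_prod_neq0 n : ((cyclotomic_prod n p%:Z)%:~R : R) != 0.
Proof. by rewrite gt_eqF // ltr0z cyclotomic_prod_gt0. Qed.

Lemma ln_norm_cyclotomicM n (y : R) : y != 0 ->
  ln `|(cyclotomic_prod n p%:Z)%:~R * y| = ln_cyclotomic_prod R p n + ln `|y|.
Proof.
move=> y0; rewrite normrM lnM ?posrE ?normr_gt0 ?cyclotomic_prod_neq0 //.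
by rewrite gtr0_norm // ltr0z cyclotomic_prod_gt0.
Qed.

Lemma legendre_remainder_neq0 n : (0 < n)%N -> legendre_remainder R p n != 0.
Proof.
move=> n0; have := legendre_remainder_gt0 R p p_gt1 n n0.
by apply: contraTneq => ->; rewrite mulr0 ltxx.
Qed.

(** The exponent is [3 / 2 + 3 / pi ^ 2], from [P_n(p ^ n)] and [d_n] respectively. *)
Lemma ln_approx_b : quad_small R (fun n => ln `|approx_b R p n| -
  3 * (pi ^+ 2 + 2) / (2 * pi ^+ 2) * ln pr * n%:R ^+ 2).
Proof.
have pi0 : (pi : R) != 0 by rewrite gt_eqF // pi_gt0.
apply: (quad_small_pos _ _ (fun n =>
  `|ln_cyclotomic_prod R p n - 3 * ln pr / pi ^+ 2 * n%:R ^+ 2| + (ln 2 + ln pr) * n%:R)).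
  move=> n n0.
  have P0 : (P n).[pr ^+ n] != 0.
    have := legendre_pn_gt0 R p p_gt1 n n0.
    by apply: contraTneq => ->; rewrite mulr0 ltxx.
  rewrite /approx_b ln_norm_cyclotomicM //.
  have := ln_legendre_pn n n0; set g := ln_cyclotomic_prod _ _ _; set w := ln `|_|.
  rewrite (_ : g + w - _ = (g - 3 * ln pr / pi ^+ 2 * n%:R ^+ 2) + (w - 3 / 2 * ln pr * n%:R ^+ 2)).
    move=> h; apply: le_trans (ler_normD _ _) _.
    by apply: le_trans (ler_norm _); rewrite lerD2l.
  by move: (pi : R) pi0 => y y0; field.
apply: quad_smallD; last exact: quad_small_linear.
by apply: quad_small_pos ln_cyclotomic_prod_asymptotic => n _; rewrite normr_id.
Qed.

(** The exponent is [3 / 2 - 3 / pi ^ 2]: the decay of [R_n] less the growth of [d_n]. *)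
Lemma ln_approx_remainder :
  quad_small R (fun n => ln `|approx_b R p n * qharmonic R p - approx_a R p n| +
    3 * (pi ^+ 2 - 2) / (2 * pi ^+ 2) * ln pr * n%:R ^+ 2).
Proof.
have pi0 : (pi : R) != 0 by rewrite gt_eqF // pi_gt0.
apply: (quad_small_pos _ _ (fun n =>
  `|ln_cyclotomic_prod R p n - 3 * ln pr / pi ^+ 2 * n%:R ^+ 2| +
    (ln 2 + ln pr + (ln 2 + ln 4 + ln 9 + 5 * ln pr)) * n%:R)).
  move=> n n0; rewrite approx_remainder // ln_norm_cyclotomicM ?legendre_remainder_neq0 //.
  have := ln_legendre_remainder n n0; set g := ln_cyclotomic_prod _ _ _; set w := ln `|_|.
  rewrite (_ : g + w + _ = (g - 3 * ln pr / pi ^+ 2 * n%:R ^+ 2) + (w + 3 / 2 * ln pr * n%:R ^+ 2)).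
    move=> h; apply: le_trans (ler_normD _ _) _.
    by apply: le_trans (ler_norm _); rewrite lerD2l.
  by move: (pi : R) pi0 => y y0; field.
apply: quad_smallD; last exact: quad_small_linear.
by apply: quad_small_pos ln_cyclotomic_prod_asymptotic => n _; rewrite normr_id.
Qed.

End Asymptotics.

Theorem theorem1 (R : realType) (p : nat) (hp : (1 < p)%N) :
  let h : R := qharmonic R p in
  let a : nat -> R := approx_a R p in
  let b : nat -> R := approx_b R p in
  let c : R := 2 * pi ^+ 2 / (pi ^+ 2 - 2) in
  let l : R := p%:R `^ (- (3 * (pi ^+ 2 - 2) / (2 * pi ^+ 2))) in
  (forall n : nat, (1 <= n)%N ->
     a n \is a Num.int /\
     ((-1) ^+ n * b n \is a Num.nat /\ 0 < (-1) ^+ n * b n)) /\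
  (forall n : nat, (1 < n)%N -> 0 < (-1) ^+ n * (b n * h - a n)) /\
  ((fun n : nat => `|b n * h - a n| `^ (1 / n%:R ^+ 2)) @ \oo --> l) /\
  l < 1 /\
  @irrational R h /\
  (irrationality_measure h <= c%:E)%E /\
  (2 + 508 / 10 ^+ 3 + 28 / 10 ^+ 5 <= c /\ c < 2 + 508 / 10 ^+ 3 + 29 / 10 ^+ 5).
Proof.
move=> h a b c l.
have /andP[P1 P2] := pi_sqr_bounds R.
have lp := ln_pr_gt0 R p hp.
have sqr_pi0 : 0 < pi ^+ 2 - 2 :> R by lra.
pose A : R := 3 * (pi ^+ 2 - 2) / (2 * pi ^+ 2) * ln p%:R.
pose B : R := 3 * (pi ^+ 2 + 2) / (2 * pi ^+ 2) * ln p%:R.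
have A0 : 0 < A by rewrite mulr_gt0 // divr_gt0 // mulr_gt0 //; lra.
have B0 : 0 < B by rewrite mulr_gt0 // divr_gt0 // mulr_gt0 //; lra.
(* [A] and [B] differ only in the sign of the 2, so [B / A = (pi ^ 2 + 2) / (pi ^ 2 - 2)]. *)
have cE : c = 1 + B / A.
  rewrite /c /A /B; move: (pi ^+ 2 : R) (ln p%:R : R) lp sqr_pi0 P1 {A0 B0 A B c l P2} => x y y0 x2 P1.
  by field; apply/and3P; split; apply/negP => /eqP; lra.
have lE : l = expR (- A).
  by rewrite /l /powR pnatr_eq0 -[p == 0]negbK -lt0n ltnW // mulNr.
have a_int n : (0 < n)%N -> a n \is a Num.int by exact: approx_a_int.
have b_nat n : (0 < n)%N -> (-1) ^+ n * b n \is a Num.nat by exact: approx_b_nat.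
have b_gt0 n : (0 < n)%N -> 0 < (-1) ^+ n * b n by exact: approx_b_gt0.
have l_gt0 n : (0 < n)%N -> 0 < (-1) ^+ n * (b n * h - a n).
  by exact: approx_remainder_gt0.
have b_int n : (0 < n)%N -> b n \is a Num.int.
  move=> n0; rewrite (_ : b n = (-1) ^+ n * ((-1) ^+ n * b n)).
    by rewrite rpredM ?rpredX ?rpredN ?rpred1 // intr_nat // b_nat.
  by rewrite mulrA -expr2 sqrr_sign mul1r.
have b_neq0 n : (0 < n)%N -> b n != 0.
  by move=> n0; have := b_gt0 n n0; apply: contraTneq => ->; rewrite mulr0 ltxx.
have l_neq0 n : (0 < n)%N -> b n * h - a n != 0.
  by move=> n0; have := l_gt0 n n0; apply: contraTneq => ->; rewrite mulr0 ltxx.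
have ln_l := ln_approx_remainder R p hp; have ln_b := ln_approx_b R p hp.
split; first by move=> n n0; split; [exact: a_int | split; [exact: b_nat | exact: b_gt0]].
split; first by move=> n n1; apply: l_gt0; exact: ltnW.
split; first by rewrite lE; exact: quad_small_root_cvg.
split; first by rewrite lE expR_lt1 oppr_lt0.
split; first exact: (approximation_irrational R h a b A A0 a_int b_int l_neq0 ln_l).
split.
  by rewrite cE; exact: (irrationality_measure_le R h a b A B A0 B0 a_int b_int b_neq0 l_neq0 ln_l ln_b).
(* With [pi ^ 2] occurring once, the decimals become linear inequalities in [pi ^ 2]. *)
have -> : c = 2 + 4 / (pi ^+ 2 - 2) by rewrite /c; move: (pi ^+ 2 : R) sqr_pi0 {l lE A B A0 B0 cE ln_l ln_b P1 P2} => y y0; field; rewrite gt_eqF.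
split.
  by rewrite -lerBlDl ler_pdivlMr //; lra.
by rewrite -ltrBrDl ltr_pdivrMr //; lra.
Qed.
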